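(* Let $G$ be a nilpotent group of nilpotency class $c>2$ and let $n=\lceil \log_2(\frac{c+1}{3})\rceil$. If $\exp(G)$ is odd, then $\exp(G\wedge G)$ divides $(\exp(G))^n$. In particular, $\exp(M(G))$ divides $(\exp(G))^n$.
   Context: Conventions: ${}^g h = ghg^{-1}$, $[g,h]=ghg^{-1}h^{-1}$. The nonabelian tensor square $G\otimes G$ is generated by symbols $g\otimes h$ subject to $gg'\otimes h=({}^g g'\otimes {}^g h)(g\otimes h)$ and $g\otimes hh'=(g\otimes h)({}^h g\otimes {}^h h')$; the exterior square $G\wedge G$ is its quotient by the subgroup generated by all $x\otimes x$. $M(G)$ is the kernel of the homomorphism $G\wedge G\to[G,G]$, $g\wedge h\mapsto[g,h]$, and is isomorphic to $H_2(G,\mathbb{Z})$. *)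

(* Defs.v *)
From mathcomp Require Import all_boot.
Set Implicit Arguments.
Unset Strict Implicit.
Unset Printing Implicit Defensive.

Record Grp := {
  gcarrier :> Type;
  gmul : gcarrier -> gcarrier -> gcarrier;
  gone : gcarrier;
  ginv : gcarrier -> gcarrier;
  gmulA : forall x y z, gmul x (gmul y z) = gmul (gmul x y) z;
  gmul1 : forall x, gmul gone x = x;
  gmulV : forall x, gmul (ginv x) x = gone
}.

Section GroupDefs.
Variable G : Grp.

Fixpoint gpow (x : G) (n : nat) : G :=
  if n is n'.+1 then gmul x (gpow x n') else @gone G.

Definition gconj (g h : G) : G := gmul (gmul g h) (ginv g).
Definition gcomm (g h : G) : G :=
  gmul (gmul (gmul g h) (ginv g)) (ginv h).

Inductive gen (S : G -> Prop) : G -> Prop :=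
| gen_one : gen S (@gone G)
| gen_in x : S x -> gen S x
| gen_inv x : gen S x -> gen S (ginv x)
| gen_mul x y : gen S x -> gen S y -> gen S (gmul x y).

Fixpoint gamma (i : nat) : G -> Prop :=
  match i with
  | 0 => fun _ => True
  | 1 => fun _ => True
  | i'.+1 => gen (fun z => exists x y, gamma i' y /\ z = gcomm x y)
  end.

Definition nilpotent_class (c : nat) : Prop :=
  (forall x, gamma c.+1 x -> x = @gone G) /\ (exists x, gamma c x /\ x <> @gone G).

Definition has_exponent (e : nat) : Prop :=
  0 < e /\ (forall x, gpow x e = @gone G) /\
  (forall m, 0 < m -> (forall x, gpow x m = @gone G) -> e <= m).

(* Exterior square G /\ G by generators and relations.
   A letter (g, h, false) stands for g /\ h, (g, h, true) for (g /\ h)^-1. *)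
Definition word := seq ((G * G) * bool).

Inductive ext_eq : word -> word -> Prop :=
| ext_refl w : ext_eq w w
| ext_sym u v : ext_eq u v -> ext_eq v u
| ext_trans u v w : ext_eq u v -> ext_eq v w -> ext_eq u w
| ext_cat u u' v v' : ext_eq u u' -> ext_eq v v' -> ext_eq (u ++ v) (u' ++ v')
| ext_cancel a b : ext_eq [:: (a, b); (a, ~~ b)] [::]
| ext_rel1 g g' h :
    ext_eq [:: (gmul g g', h, false)]
           [:: (gconj g g', gconj g h, false); (g, h, false)]
| ext_rel2 g h h' :
    ext_eq [:: (g, gmul h h', false)]
           [:: (g, h, false); (gconj h g, gconj h h', false)]
| ext_rel3 g : ext_eq [:: (g, g, false)] [::].

Definition wpow (w : word) (n : nat) : word := flatten (nseq n w).

Definition ext_comm (w : word) : G :=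
  foldr (fun l acc =>
           let: (g, h, b) := l in
           gmul (if b then ginv (gcomm g h) else gcomm g h) acc)
        (@gone G) w.

Definition ext_exp_dvd (N : nat) : Prop :=
  forall w : word, ext_eq (wpow w N) [::].

(* exp(M(G)) divides N, where M(G) = ker (G /\ G -> [G,G]) *)
Definition schur_exp_dvd (N : nat) : Prop :=
  forall w : word, ext_comm w = @gone G -> ext_eq (wpow w N) [::].

End GroupDefs.

(* Main.v *)
(* G /\ G is realised as the derived subgroup of a central extension H of (a subgroup of) G,
   obtained from G /\ G itself by adjoining one element of G after another as a semidirect
   product with a cyclic group. In H every e-th power is central and the class is at most
   c + 1, so it suffices to show that [H, H] has exponent dividing e ^ n when gamma_(3 * 2^n + 1)(H)
   is trivial. The top half gamma_(M + 1) of a group of class 2 M is abelian of exponent e,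
   which reduces to class 6. There, expanding 1 = ([y, x] x)^e x^-e expresses [y, x]^e through
   the powers of [x, x, [y, x]] and [x, x, x, x, [y, x]] with exponents 'C(e, 3) and 'C(e, 5),
   which only matter at the primes 3 and 5. At 3, the relations make the 5-linear form
   [a, [b, [c, [d, e]]]] ^ 'C(e, 3) fully alternating, hence zero; then the invariance of
   [y, x] under y |-> y x^j kills what is left, both at 3 and at 5. *)
Require Import Defs.
From HB Require Import structures.
From mathcomp Require Import all_boot all_algebra zify boolp.
Set Implicit Arguments.
Unset Strict Implicit.
Unset Printing Implicit Defensive.
Import GRing.Theory.

(** The halving step alone would start from class 2 and reach class 2 ^ n with exponent e ^ n. The
    factor 3 in the bound comes from starting at class 6 = 3 * 2 with a single factor e. In class
    six, oddness of e disposes of the exponents 'C(e, 2) and 'C(e, 4), while for 'C(e, 3) and 'C(e,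
    5) only e %| 3 * 'C(e, 3) and e %| 5 * 'C(e, 5) hold. The two primes are separated by proving
    exponents e * 5 and e * 3: the fifth power removes the 'C(e, 5) term and leaves a form killed by
    3, the third power does the converse. The alternation argument in weight five needs [gamma 6] to
    be killed by 'C(e, 3). This is a bootstrap: in H / gamma_6 the condition is void, and the
    conclusion there yields it in H. No presentation of G is used: a statement on exponents is
    checked on one element of G /\ G at a time, so only the finitely many elements of G occurring in
    one word are adjoined. They are adjoined singly because lifts taken from one cyclic group
    commute, in agreement with the vanishing of their wedge. *)

Lemma dvdn_bin_odd e : odd e ->
  [/\ e %| 'C(e, 2), e %| 'C(e, 4), e %| 3 * 'C(e, 3) & e %| 5 * 'C(e, 5)].
Proof.
case: e => // e oe.
(* After [case] the exponent reads [e.+1]. The absorption identity leaves a factor [m.+1]; 2 and 4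
   are coprime to an odd number and cancel, 3 and 5 need not be. *)
have D m : e.+1 %| m.+1 * 'C(e.+1, m.+1) by rewrite -mul_bin_diag dvdn_mulr.
have c2 : coprime e.+1 2 by rewrite coprimen2.
split; [| |exact: (D 2)|exact: (D 4)].
  by rewrite -(Gauss_dvdr _ c2); exact: (D 1).
have c4 : coprime e.+1 4 by rewrite (_ : 4 = 2 * 2)%N // coprimeMr c2.
by rewrite -(Gauss_dvdr _ c4); exact: (D 3).
Qed.

(** * Linear identities in abelian groups by reflection *)

Inductive ab_exp :=
  AbVar of nat | Ab0 | AbAdd of ab_exp & ab_exp | AbOpp of ab_exp | AbMul of ab_exp & nat.

Section AbelianReflection.
Variable V : zmodType.
Local Open Scope ring_scope.

Fixpoint ab_eval (env : seq V) e : V :=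
  match e with
  | AbVar i => env`_i
  | Ab0 => 0
  | AbAdd a b => ab_eval env a + ab_eval env b
  | AbOpp a => - ab_eval env a
  | AbMul a n => ab_eval env a *+ n
  end.

Fixpoint ab_coef e (i : nat) : int :=
  match e with
  | AbVar j => (i == j)%:Z
  | Ab0 => 0
  | AbAdd a b => ab_coef a i + ab_coef b i
  | AbOpp a => - ab_coef a i
  | AbMul a n => ab_coef a i * n%:Z
  end.

Lemma ab_evalE env e : ab_eval env e = \sum_(i < size env) env`_i *~ ab_coef e i.
Proof.
elim: e => /= [j||a -> b ->|a ->|a -> n].
- have [lt|ge] := ltnP j (size env).
    rewrite (bigD1 (Ordinal lt)) //= eqxx mulr1z big1 ?addr0 // => i ne.
    by rewrite (_ : (i == j :> nat) = false) ?mulr0z //; apply: negbTE; move: ne; rewrite -val_eqE.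
  rewrite nth_default // big1 // => i _.
  by rewrite (_ : (i == j :> nat) = false) ?mulr0z //; apply/negbTE; have := ltn_ord i; lia.
- by rewrite big1.
- by rewrite -big_split; apply: eq_bigr => i _; rewrite /= mulrzDr.
- by rewrite -sumrN; apply: eq_bigr => i _; rewrite mulrNz.
- by rewrite -sumrMnl; apply: eq_bigr => i _; rewrite mulrzA pmulrn.
Qed.

(** The two sides differ by a combination of multiples [v *+ m]. For [m = 0] divisibility is
    equality of coefficients and the torsion condition is trivial, so one lemma serves both
    tactics. *)
Lemma ab_mod (m : nat) env e1 e2 :
  all (fun v => v *+ m == 0) env ->
  all (fun i => m %| absz (ab_coef e1 i - ab_coef e2 i))%N (iota 0 (size env)) ->
  ab_eval env e1 = ab_eval env e2.
Proof.
move=> tors /allP chk; apply/eqP; rewrite -subr_eq0 !ab_evalE -sumrB big1 // => i _.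
rewrite -mulrzBr; have /chk/dvdnP[q E] : (i : nat) \in iota 0 (size env) by rewrite mem_iota /=.
have vm : env`_i *+ m = 0 by apply/eqP; move/(all_nthP 0): tors; apply.
have vz : env`_i *~ (q * m)%N%:Z = 0 by rewrite -pmulrn mulnC mulrnA vm mul0rn.
by case: (intP (ab_coef e1 i - ab_coef e2 i)) E => [|n|n] /= E; rewrite ?mulr0z // ?mulrNz;
  move: E vz => /= <-; rewrite ?oppr0 // => ->; rewrite ?oppr0.
Qed.

End AbelianReflection.

Ltac ab_index x l :=
  lazymatch l with
  | x :: _ => constr:(0%N)
  | _ :: ?l' => let n := ab_index x l' in constr:(n.+1)
  end.
Ltac ab_member x l :=
  lazymatch l with
  | [::] => constr:(false)
  | x :: _ => constr:(true)
  | _ :: ?l' => ab_member x l'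
  end.
Ltac ab_atoms t l :=
  lazymatch t with
  | (?a + ?b)%R => let l' := ab_atoms a l in ab_atoms b l'
  | (- ?a)%R => ab_atoms a l
  | (?a *+ _)%R => ab_atoms a l
  | 0%R => l
  | _ => let b := ab_member t l in
         lazymatch b with true => l | false => constr:(t :: l) end
  end.
Ltac ab_reify t l :=
  lazymatch t with
  | (?a + ?b)%R => let x := ab_reify a l in let y := ab_reify b l in constr:(AbAdd x y)
  | (- ?a)%R => let x := ab_reify a l in constr:(AbOpp x)
  | (?a *+ ?n)%R => let x := ab_reify a l in constr:(AbMul x n)
  | 0%R => constr:(Ab0)
  | _ => let n := ab_index t l in constr:(AbVar n)
  end.
(* Proves an identity between integer combinations of atoms that are all killed by [m]
   (no condition when [m] is 0); [tac] discharges the torsion conditions. *)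
Ltac abel_mod m tac :=
  lazymatch goal with
  | |- @eq ?V ?a ?b =>
    let l := ab_atoms a (@nil V) in
    let l := ab_atoms b l in
    let x := ab_reify a l in
    let y := ab_reify b l in
    apply: (@ab_mod _ m l x y); [tac | by vm_compute]
  end.
Ltac abel := abel_mod 0%N ltac:(by apply/allP).

(** * Groups and lower central series *)

Declare Scope grp_scope.
Delimit Scope grp_scope with grp.
Notation "x * y" := (gmul x y) : grp_scope.
Notation "x ^-1" := (ginv x) : grp_scope.
Notation "1" := (gone _) : grp_scope.
Notation "x ^+ n" := (gpow x n%N) : grp_scope.
Notation "[ ~ x , y ]" := (gcomm x y) : grp_scope.
Local Open Scope grp_scope.

Section GroupTheory.
Variable G : Grp.
Implicit Types (x y z : G) (n m i j : nat).

Lemma gmulVK x y : x^-1 * (x * y) = y.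
Proof. by rewrite gmulA gmulV gmul1. Qed.

Lemma gmulVr x : x * x^-1 = 1.
Proof.
have E : x^-1^-1 * (x^-1 * (x * x^-1)) = 1 by rewrite (gmulVK x) gmulV.
by rewrite gmulA gmulV gmul1 in E.
Qed.

Lemma gmulr1 x : x * 1 = x.
Proof. by rewrite -(gmulV x) gmulA gmulVr gmul1. Qed.

Lemma gmulVKr x y : x * (x^-1 * y) = y.
Proof. by rewrite gmulA gmulVr gmul1. Qed.

Lemma gmul_cancel x y z : x * y = x * z -> y = z.
Proof. by move=> E; rewrite -(gmulVK x y) E gmulVK. Qed.

Lemma ginvK x : x^-1^-1 = x.
Proof. by apply: (@gmul_cancel x^-1); rewrite gmulVr gmulV. Qed.

Lemma ginvM x y : (x * y)^-1 = y^-1 * x^-1.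
Proof. by apply: (@gmul_cancel (x * y)); rewrite gmulVr -gmulA gmulVKr gmulVr. Qed.

Lemma ginv1 : (1 : G)^-1 = 1.
Proof. by rewrite -[LHS]gmul1 gmulVr. Qed.

Lemma gmulAr x y z : x * y * z = x * (y * z).
Proof. by rewrite gmulA. Qed.

End GroupTheory.

(* Knuth-Bendix completion of the group axioms: decides equality of words in a free group. *)
Ltac grp_norm :=
  rewrite /gcomm /gconj;
  rewrite ?(gmulAr, ginvM, ginvK, ginv1, gmul1, gmulr1, gmulV, gmulVr, gmulVK, gmulVKr).
Ltac grp := by grp_norm.

Section Powers.
Variable G : Grp.
Implicit Types (x y z a b c : G) (n m i j : nat).

Lemma gmulIr z x y : x * z = y * z -> x = y.
Proof. by move=> E; rewrite -(gmulr1 x) -(gmulVr z) gmulA E; grp. Qed.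

Lemma gcomm1P x y : [~ x, y] = 1 <-> x * y = y * x.
Proof.
split=> [E|E]; last by rewrite /gcomm E; grp.
by rewrite -[RHS]gmul1 -E; grp.
Qed.

Lemma gcommx1 x : [~ x, 1] = 1. Proof. grp. Qed.
Lemma gcomm1x x : [~ 1, x] = 1. Proof. grp. Qed.
Lemma gcommxx x : [~ x, x] = 1. Proof. grp. Qed.
Lemma gcommV x y : [~ x, y]^-1 = [~ y, x]. Proof. grp. Qed.
Lemma gconjE x y : x * y * x^-1 = [~ x, y] * y. Proof. grp. Qed.

Lemma gpowS x n : x ^+ n.+1 = x * x ^+ n. Proof. by []. Qed.
Lemma gpow1 x : x ^+ 1 = x. Proof. by rewrite /= gmulr1. Qed.
Lemma gpow1n n : (1 : G) ^+ n = 1.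
Proof. by elim: n => //= n ->; grp. Qed.

Lemma gpowD x n m : x ^+ (n + m) = x ^+ n * x ^+ m.
Proof. by elim: n => [|n IH]; rewrite ?gmul1 // addSn !gpowS IH gmulA. Qed.

Lemma gpowM x n m : x ^+ (n * m) = (x ^+ n) ^+ m.
Proof. by elim: m => [|m IH]; rewrite ?muln0 // mulnS gpowD IH. Qed.

Lemma gpowSr x n : x ^+ n.+1 = x ^+ n * x.
Proof. by rewrite -addn1 gpowD gpow1. Qed.

Lemma gpow_dvd x n m : x ^+ n = 1 -> n %| m -> x ^+ m = 1.
Proof. by move=> E /dvdnP[q ->]; rewrite mulnC gpowM E gpow1n. Qed.

Lemma gcommute_pow x y n : x * y = y * x -> x * y ^+ n = y ^+ n * x.
Proof.
move=> E; elim: n => [|n IH]; first grp.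
by rewrite gpowS gmulA E gmulAr IH gmulA.
Qed.

Lemma gpowMn x y n : x * y = y * x -> (x * y) ^+ n = x ^+ n * y ^+ n.
Proof.
move=> E; elim: n => [|n IH]; first grp.
rewrite !gpowS IH !gmulAr; congr (_ * _); rewrite !gmulA; congr (_ * _).
by rewrite (gcommute_pow n (esym E)).
Qed.

Lemma gpowV x n : (x^-1) ^+ n = (x ^+ n)^-1.
Proof. by elim: n => [|n IH]; rewrite ?ginv1 // gpowS IH gpowSr ginvM. Qed.

Lemma gpow_conj x y n : (x * y * x^-1) ^+ n = x * y ^+ n * x^-1.
Proof. by elim: n => [|n IH]; [grp | rewrite !gpowS IH; grp]. Qed.

Lemma gpow_coprime x n m k : x ^+ (n * k) = 1 -> x ^+ (m * k) = 1 ->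
  coprime n m -> 0 < n -> x ^+ k = 1.
Proof.
move=> En Em co n0; case: (egcdnP m n0) => u v E _.
have : x ^+ (u * n * k) = 1 by rewrite -mulnA mulnC gpowM En gpow1n.
rewrite E mulnDl gpowD -mulnA mulnC gpowM Em gpow1n gmul1.
by rewrite (eqP co) mul1n.
Qed.

End Powers.

Section Gamma.
Variable G : Grp.
Implicit Types (x y z a b c : G) (n m i j : nat).
Local Notation gam i := (@gamma G i).

Lemma gamma1 x : gam 1 x. Proof. by []. Qed.

Lemma gamma_ind i (P : G -> Prop) :
  P 1 -> (forall x y, gam i.+1 y -> P [~ x, y]) ->
  (forall x, gam i.+2 x -> P x -> P x^-1) ->
  (forall x y, gam i.+2 x -> P x -> gam i.+2 y -> P y -> P (x * y)) ->
  forall x, gam i.+2 x -> P x.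
Proof.
move=> P1 PC PV PM x; elim=> {x} [|_ [x [y [gy ->]]]|x gx IH|x y gx IHx gy IHy].
- exact: P1.
- exact: PC.
- exact: PV.
- exact: PM.
Qed.

Lemma gamma_one i : gam i 1.
Proof. case: i => [|[|i]] //; exact: gen_one. Qed.

Lemma gamma_mul i x y : gam i x -> gam i y -> gam i (x * y).
Proof. case: i => [|[|i]] //; exact: gen_mul. Qed.

Lemma gamma_inv i x : gam i x -> gam i x^-1.
Proof. case: i => [|[|i]] //; exact: gen_inv. Qed.

Lemma gamma_pow i x n : gam i x -> gam i (x ^+ n).
Proof. by move=> gx; elim: n => [|n IH]; [exact: gamma_one | exact: gamma_mul]. Qed.

Lemma gamma_conj i g x : gam i x -> gam i (g * x * g^-1).
Proof.
elim: i x => [|[|i] IH] // x; elim=> {x} [|z [x [y [gy ->]]]|x _ IHx|x y _ IHx _ IHy].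
- by rewrite (_ : _ * _ * _ = 1); [exact: gamma_one | grp].
- rewrite (_ : _ * _ * _ = [~ g * x * g^-1, g * y * g^-1]); last grp.
  by apply: gen_in; exists (g * x * g^-1), (g * y * g^-1); split=> //; apply: IH.
- by rewrite (_ : _ * _ * _ = (g * x * g^-1)^-1); [exact: gen_inv | grp].
- by rewrite (_ : _ * _ * _ = (g * x * g^-1) * (g * y * g^-1)); [exact: gen_mul | grp].
Qed.

Lemma gamma_commS i x y : gam i y -> gam i.+1 [~ x, y].
Proof. by case: i => [|i] //= gy; apply: gen_in; exists x, y. Qed.

Lemma gammaS i x : gam i.+1 x -> gam i x.
Proof.
case: i x => [|[|i]] // x; elim=> {x} [|z [x [y [gy ->]]]|x _ IHx|x y _ IHx _ IHy].
- exact: gamma_one.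
- rewrite (_ : [~ x, y] = (x * y * x^-1) * y^-1); last grp.
  by apply: gamma_mul; [apply: gamma_conj | apply: gamma_inv].
- exact: gamma_inv.
- exact: gamma_mul.
Qed.

Lemma gamma_leq i j x : i <= j -> gam j x -> gam i x.
Proof. by move/subnK <-; elim: (j - i) => // n IH /gammaS. Qed.

(* The Hall-Witt identity writes [[x, u], y] as a product of conjugates of commutators
   [x, [u', y']] and [u', [x', y]], which the induction hypothesis controls. *)
Lemma gamma_comm i j x y : gam i x -> gam j y -> gam (i + j) [~ x, y].
Proof.
elim: i j x y => [|[|i] IH] j x y; first by move=> _ gy; apply/gammaS/gamma_commS.
  by move=> _ gy; exact: gamma_commS.
move=> gx; elim: gx y => {x} [|z [x [u [gu ->]]]|x _ IHx|x x' _ IHx _ IHx'] y gy.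
- by rewrite gcomm1x; exact: gamma_one.
- rewrite (_ : [~ [~ x, u], y] = [~ x, u] * (u *
      (y * [~ x, [~ u^-1, y^-1]^-1]^-1 * y^-1 *
       (x * [~ u^-1, [~ x^-1, y]]^-1 * x^-1))^-1 * u^-1)^-1 * [~ x, u]^-1); last grp.
  apply/gamma_conj/gamma_inv/gamma_conj/gamma_inv/gamma_mul; apply/gamma_conj/gamma_inv.
    by apply: gamma_commS; apply/gamma_inv/IH; apply: gamma_inv.
  by rewrite addSnnS; apply: IH; [exact: gamma_inv | exact: gamma_commS].
- rewrite (_ : [~ x^-1, y] = x^-1 * [~ x, y]^-1 * x^-1^-1); last grp.
  by apply/gamma_conj/gamma_inv/IHx.
- rewrite (_ : [~ x * x', y] = (x * [~ x', y] * x^-1) * [~ x, y]); last grp.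
  by apply: gamma_mul; [apply/gamma_conj/IHx' | apply: IHx].
Qed.

End Gamma.

(** * Quotients *)

Lemma sval_inj (T : Type) (P : T -> Prop) (p q : {x | P x}) : sval p = sval q -> p = q.
Proof.
case: p q => [x px] [y py] /= E; case: y / E py => py.
congr exist; exact: Prop_irrelevance.
Qed.

Section Quotient.
Variables (T : Type) (R : T -> T -> Prop) (m : T -> T -> T) (u : T) (i : T -> T).
Hypothesis Rrefl : forall x, R x x.
Hypothesis Rsym : forall x y, R x y -> R y x.
Hypothesis Rtrans : forall x y z, R x y -> R y z -> R x z.
Hypothesis Rm : forall x x' y y', R x x' -> R y y' -> R (m x y) (m x' y').
Hypothesis mA : forall x y z, R (m x (m y z)) (m (m x y) z).
Hypothesis m1 : forall x, R (m u x) x.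
Hypothesis mV : forall x, R (m (i x) x) u.

(** A class is the predicate [R x] itself, so extensionality turns [R] into equality. The
    construction serves for quotients by [gamma i] and for words modulo [ext_eq]. *)
Definition quot_type := {P : T -> Prop | exists x, P = R x}.
Definition quot_cls (x : T) : quot_type := exist _ (R x) (ex_intro _ x erefl).
Definition quot_repr (q : quot_type) : T := sval (cid (svalP q)).

Lemma quot_clsP x y : quot_cls x = quot_cls y <-> R x y.
Proof.
split=> [E|xy]; first by have /= -> := congr1 sval E.
apply: sval_inj; apply/funext => z; apply/propext; split => [xz|].
  exact: Rtrans (Rsym xy) xz.
exact: Rtrans.
Qed.

Lemma quot_reprK q : quot_cls (quot_repr q) = q.
Proof. by apply: sval_inj; exact: esym (svalP (cid (svalP q))). Qed.

Let RK x : R (quot_repr (quot_cls x)) x.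
Proof. by apply/quot_clsP; rewrite quot_reprK. Qed.

Definition quot_mul p q := quot_cls (m (quot_repr p) (quot_repr q)).
Definition quot_inv p := quot_cls (i (quot_repr p)).

Lemma quot_mulA p q r : quot_mul p (quot_mul q r) = quot_mul (quot_mul p q) r.
Proof.
apply/quot_clsP; apply: Rtrans (Rm (Rrefl _) (RK _)) _.
by apply: Rtrans (Rsym (Rm (RK _) (Rrefl _))).
Qed.

Lemma quot_mul1 p : quot_mul (quot_cls u) p = p.
Proof. rewrite -[RHS]quot_reprK; apply/quot_clsP; exact: Rtrans (Rm (RK _) (Rrefl _)) _. Qed.

Lemma quot_mulV p : quot_mul (quot_inv p) p = quot_cls u.
Proof. apply/quot_clsP; exact: Rtrans (Rm (RK _) (Rrefl _)) _. Qed.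

Definition quot_grp : Grp := Build_Grp quot_mulA quot_mul1 quot_mulV.

Lemma quot_clsM x y : quot_cls (m x y) = gmul (quot_cls x : quot_grp) (quot_cls y).
Proof. by apply/quot_clsP; apply: Rm; apply: Rsym. Qed.

End Quotient.

Definition is_hom (G K : Grp) (f : G -> K) := forall x y, f (x * y) = f x * f y.

Section Homs.
Variables (G K : Grp) (f : G -> K).
Hypothesis fM : is_hom f.

Lemma hom1 : f 1 = 1.
Proof. by apply: (@gmul_cancel K (f 1)); rewrite -fM !gmulr1. Qed.

Lemma homV x : f x^-1 = (f x)^-1.
Proof. by apply: (@gmul_cancel K (f x)); rewrite -fM !gmulVr hom1. Qed.

Lemma homX x n : f (x ^+ n) = f x ^+ n.
Proof. by elim: n => [|n IH]; [exact: hom1 | rewrite gpowS fM IH]. Qed.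

Lemma homR x y : f [~ x, y] = [~ f x, f y].
Proof. by rewrite /gcomm !fM !homV. Qed.

Lemma hom_gamma i x : gamma i x -> gamma i (f x).
Proof.
elim: i x => [|[|i] IH] // x; elim=> {x} [|z [x [y [gy ->]]]|x _ IHx|x y _ IHx _ IHy].
- by rewrite hom1; exact: gamma_one.
- by rewrite homR; apply: gamma_commS; exact: IH.
- by rewrite homV; exact: gamma_inv.
- by rewrite fM; exact: gamma_mul.
Qed.

Lemma hom_gamma_surj i y : (forall z, exists x, f x = z) ->
  gamma i y -> exists2 x, gamma i x & f x = y.
Proof.
move=> surj; elim: i y => [|[|i] IH] y.
- by move=> _; case: (surj y) => x; exists x.
- by move=> _; case: (surj y) => x; exists x.
elim=> {y} [|z [x [y [/IH[y' gy' <-] ->]]]|_ _ [x' gx' <-]|_ _ _ [x' gx' <-] _ [y' gy' <-]].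
- by exists 1; [exact: gamma_one | exact: hom1].
- case: (surj x) => x' <-; exists [~ x', y']; [exact: gamma_commS | exact: homR].
- by exists x'^-1; [exact: gamma_inv | exact: homV].
- by exists (x' * y'); [exact: gamma_mul | exact: fM].
Qed.

End Homs.

Lemma gamma_quotient (H : Grp) i : exists (Q : Grp) (f : H -> Q),
  [/\ is_hom f, forall z, exists x, f x = z & forall x, f x = 1 <-> gamma i x].
Proof.
pose R (x y : H) := gamma i (x * y^-1).
have Rr x : R x x by rewrite /R gmulVr; exact: gamma_one.
have Rs x y : R x y -> R y x by move/gamma_inv; rewrite /R; grp_norm.
have Rt x y z : R x y -> R y z -> R x z.
  by move=> xy /(gamma_mul xy); rewrite /R; grp_norm.
have Rm x x' y y' : R x x' -> R y y' -> R (x * y) (x' * y').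
  move=> xx yy; rewrite /R.
  rewrite (_ : _ * _ = (x * (y * y'^-1) * x^-1) * (x * x'^-1)); last grp.
  by apply: gamma_mul => //; exact: gamma_conj.
have RE x y : x = y -> R x y by move=> ->.
pose Q := quot_grp Rr Rs Rt Rm (fun x y z => RE _ _ (gmulA x y z))
  (fun x => RE _ _ (gmul1 x)) (fun x => RE _ _ (gmulV x)).
exists Q, (quot_cls R); split.
- by move=> x y; apply: quot_clsM.
- by move=> z; exists (quot_repr z); apply: quot_reprK.
- have E x : R x 1 <-> gamma i x by rewrite /R ginv1 gmulr1.
  by move=> x; rewrite -E; exact: quot_clsP.
Qed.

Section AbelianGamma.
Variables (H : Grp) (i : nat).
Hypothesis gC : forall x y : H, gamma i x -> gamma i y -> gmul x y = gmul y x.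

(** The commutativity proof is part of the type, so that the zmodule instance, whose law [addC]
    rests on it, can be inferred. *)
Definition abgamma of (forall x y : H, gamma i x -> gamma i y -> gmul x y = gmul y x) : Type :=
  {x : H | gamma i x}.
Local Notation W := (abgamma gC).

Let add (p q : W) : W := exist _ _ (gamma_mul (svalP p) (svalP q)).
Let opp (p : W) : W := exist _ _ (gamma_inv (svalP p)).
Let zero : W := exist _ _ (gamma_one H i).

Let addA : associative add. Proof. by move=> p q r; apply: sval_inj; exact: gmulA. Qed.
Let addC : commutative add.
Proof. by move=> p q; apply: sval_inj; apply: gC; exact: svalP. Qed.
Let add0 : left_id zero add. Proof. by move=> p; apply: sval_inj; exact: gmul1. Qed.
Let addN : left_inverse zero opp add. Proof. by move=> p; apply: sval_inj; exact: gmulV. Qed.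

HB.instance Definition _ := gen_eqMixin W.
HB.instance Definition _ := gen_choiceMixin W.
HB.instance Definition _ := GRing.isZmodule.Build W addA addC add0 addN.

(** Total, with default value 0 outside [gamma i], so that it applies to group expressions whose
    membership is proved separately. *)
Definition to_ab (x : H) : W :=
  if pselect (gamma i x) is left gx then exist _ x gx else 0%R.

Lemma to_abE x : gamma i x -> sval (to_ab x) = x.
Proof. by rewrite /to_ab; case: pselect. Qed.

Lemma to_abM x y : gamma i x -> gamma i y -> to_ab (gmul x y) = (to_ab x + to_ab y)%R.
Proof.
move=> gx gy; apply: sval_inj; rewrite to_abE; last exact: gamma_mul.
by rewrite /= !to_abE.
Qed.

Lemma to_ab1 : to_ab (gone H) = 0%R.
Proof. by apply: sval_inj; rewrite to_abE //; exact: gamma_one. Qed.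

Lemma to_abX x n : gamma i x -> to_ab (gpow x n) = (to_ab x *+ n)%R.
Proof.
move=> gx; elim: n => [|n IH]; first by rewrite to_ab1.
by rewrite mulrS -IH gpowS to_abM //; exact: gamma_pow.
Qed.

Lemma to_ab_eq0 x : gamma i x -> to_ab x = 0%R -> x = gone H.
Proof. by move=> gx E; rewrite -(to_abE gx) E. Qed.

End AbelianGamma.

(** * Congruences modulo the lower central series *)

Section Congruence.
Variable G : Grp.
Implicit Types (x y z a b c u v w r s : G) (l : seq G) (n m i j k : nat).

Definition eqg i x y := gamma i (x * y^-1).

Lemma eqg_refl i x : eqg i x x.
Proof. by rewrite /eqg gmulVr; exact: gamma_one. Qed.

Lemma eqg_sym i x y : eqg i x y -> eqg i y x.
Proof. by rewrite /eqg => /gamma_inv; rewrite ginvM ginvK. Qed.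

Lemma eqg_trans i y x z : eqg i x y -> eqg i y z -> eqg i x z.
Proof. by rewrite /eqg => xy /(gamma_mul xy); rewrite gmulAr gmulVK. Qed.

Lemma eqg_mul i x x' y y' : eqg i x x' -> eqg i y y' -> eqg i (x * y) (x' * y').
Proof.
move=> xx yy; rewrite /eqg.
rewrite (_ : _ * _ = (x * (y * y'^-1) * x^-1) * (x * x'^-1)); last grp.
by apply: gamma_mul => //; exact: gamma_conj.
Qed.

Lemma eqg_eq i x y : (forall z, gamma i z -> z = 1) -> eqg i x y -> x = y.
Proof. by move=> g1 /g1 E; apply: (@gmulIr _ y^-1); rewrite E gmulVr. Qed.

Lemma eqg_leq i j x y : i <= j -> eqg j x y -> eqg i x y.
Proof. exact: gamma_leq. Qed.

Lemma eqg_mulC i j k x y : gamma i x -> gamma j y -> k <= i + j -> eqg k (x * y) (y * x).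
Proof.
move=> gx gy le; apply: eqg_leq le _; rewrite /eqg.
by rewrite (_ : _ * _ = [~ x, y]); [exact: gamma_comm | grp].
Qed.

Lemma eqg_comm_gamma i j x v v' : gamma i x -> eqg j v v' ->
  eqg (i + j) [~ x, v] [~ x, v'].
Proof.
rewrite /eqg; set c := v * _ => gx gc.
rewrite (_ : _ * _ = [~ x, c] * [~ c, [~ x, v']]); last by rewrite /c; grp.
apply: gamma_mul; first exact: gamma_comm.
have gxv : gamma i [~ x, v'] by rewrite -gcommV; apply: gamma_inv; apply/gammaS/gamma_commS.
by rewrite addnC; exact: gamma_comm.
Qed.

Lemma eqg_comm i x v v' : eqg i v v' -> eqg i.+1 [~ x, v] [~ x, v'].
Proof. exact: (@eqg_comm_gamma 1%N). Qed.

(** The error term is a conjugate of [v, [x, w]], of weight 2 i + 1, which is at least i + 2. *)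
Lemma eqg_lin_r i x v w : 0 < i -> gamma i v -> gamma i w ->
  eqg i.+2 [~ x, v * w] ([~ x, v] * [~ x, w]).
Proof.
move=> i0 gv gw; rewrite /eqg.
rewrite (_ : _ * _ = [~ x, v] * [~ v, [~ x, w]] * [~ x, v]^-1); last grp.
apply: gamma_conj; apply: gamma_leq (gamma_comm gv (gamma_commS x gw)); lia.
Qed.

Lemma eqg_lin_l i x y v : gamma i v -> 0 < i ->
  eqg i.+2 [~ x * y, v] ([~ x, v] * [~ y, v]).
Proof.
move=> gv i0; have gx := gamma_commS x gv; have gy := gamma_commS y gv.
rewrite (_ : [~ x * y, v] = [~ x, [~ y, v]] * ([~ y, v] * [~ x, v])); last grp.
rewrite -[[~ x, v] * _]gmul1; apply: eqg_mul.
  by rewrite /eqg ginv1 gmulr1; exact: gamma_commS.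
apply: eqg_mulC gy gx _; lia.
Qed.

(* The Jacobi identity of the associated graded Lie ring. *)
Lemma eqg_jacobi i j k a b c : 0 < k -> gamma i a -> gamma j b -> gamma k c ->
  eqg (i + j + k).+1 [~ a, [~ b, c]] ([~ b, [~ a, c]] * [~ [~ a, b], c]).
Proof.
move=> k0 ga gb gc.
have gab := gamma_comm ga gb; have gbc := gamma_comm gb gc; have gac := gamma_comm ga gc.
have gZ := gamma_comm gab gc.
have gD : gamma (i + j + k).+1 [~ [~ a, b], [~ b * a, c]].
  by rewrite -addnS; apply: gamma_comm => //; exact: gamma_commS.
(* Since a b = [a, b] (b a), expanding [a b, c] in both ways gives
   [X * (p * q) = D * (Y * (q * p) * Z)] with p = [b, c] and q = [a, c]. Exchanging p and q costs
   weight i + j + 2 k, which exceeds i + j + k because k is positive. *)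
have key X Y Z p q D : gamma (i + j + k) Z -> gamma (j + k) p -> gamma (i + k) q ->
    gamma (i + j + k).+1 D -> X * (p * q) = D * (Y * (q * p) * Z) ->
    eqg (i + j + k).+1 X (Y * Z).
  move=> gz gp gq gd E.
  have c1 : eqg (i + j + k).+1 (Y * (q * p) * Z) (Y * (Z * (p * q))).
    rewrite gmulAr; apply: eqg_mul; first exact: eqg_refl.
    apply: (@eqg_trans _ (Z * (q * p))).
      apply: eqg_mulC (gamma1 (q * p)) gz _; lia.
    apply: eqg_mul; first exact: eqg_refl.
    apply: eqg_mulC gq gp _; lia.
  have : eqg (i + j + k).+1 (X * (p * q)) (Y * (Z * (p * q))).
    rewrite E; apply: eqg_trans _ c1; rewrite -[X in eqg _ _ X]gmul1.
    by apply: eqg_mul; [rewrite /eqg ginv1 gmulr1 | exact: eqg_refl].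
  by rewrite /eqg (_ : X * (p * q) * _ = X * (Y * Z)^-1); last grp.
apply: key gZ gbc gac gD _; grp.
Qed.

(** Right-normed commutator [x1, [x2, ... [xr, v]]]. Modulo the next term of the lower central
    series it is additive in every entry. *)
Definition chain l v := foldr (fun x w => [~ x, w]) v l.

Lemma chain_gamma i l v : gamma i v -> gamma (i + size l) (chain l v).
Proof. by move=> gv; elim: l => [|x l IH] /=; rewrite ?addn0 // addnS; exact: gamma_commS. Qed.

Lemma eqg_chain i l v w : eqg i v w -> eqg (i + size l) (chain l v) (chain l w).
Proof. by move=> vw; elim: l => [|x l IH] /=; rewrite ?addn0 // addnS; exact: eqg_comm. Qed.

Lemma chain_mul i l v w : 0 < i -> gamma i v -> gamma i w ->
  eqg (i + size l).+1 (chain l (v * w)) (chain l v * chain l w).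
Proof.
move=> i0 gv gw; elim: l => [|x l IH] /=; first exact: eqg_refl.
rewrite addnS; apply: eqg_trans (eqg_comm x IH) _.
apply: eqg_lin_r; [lia | exact: chain_gamma | exact: chain_gamma].
Qed.

Lemma chain_slot i l1 x y l2 v : 0 < i -> gamma i v ->
  eqg (i + size (l1 ++ x :: l2)).+1 (chain (l1 ++ x * y :: l2) v)
    (chain (l1 ++ x :: l2) v * chain (l1 ++ y :: l2) v).
Proof.
move=> i0 gv; rewrite /chain !foldr_cat /= -!/(chain _ _) size_cat /=.
have gl := chain_gamma l2 gv.
apply: (@eqg_trans _ (chain l1 ([~ x, chain l2 v] * [~ y, chain l2 v]))).
  rewrite (_ : (_ + _).+1 = (i + size l2).+2 + size l1); last lia.
  apply/eqg_chain/eqg_lin_l => //; lia.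
rewrite (_ : (_ + _).+1 = ((i + size l2).+1 + size l1).+1); last lia.
apply: chain_mul => //; exact: gamma_commS.
Qed.

End Congruence.

(** * Multilinear relations in weight five *)

Section Polarization.
Variables (Q : Grp) (V : zmodType).
Local Open Scope ring_scope.

Lemma additive1 (f : Q -> V) : (forall x y, f (gmul x y) = f x + f y) -> f (gone Q) = 0.
Proof. by move=> fD; apply: (addrI (f (gone Q))); rewrite -fD gmul1 addr0. Qed.

Lemma additiveV (f : Q -> V) x : (forall x y, f (gmul x y) = f x + f y) ->
  f (ginv x) = - f x.
Proof. by move=> fD; apply/eqP; rewrite -addr_eq0 -fD gmulV additive1. Qed.

(** Evaluating the vanishing cubic form at x y and at x y^-1 gives S(x, y) + S(y, x) = 0 and S(y, x)
    - S(x, y) = 0, hence 2 S = 0; with 3 S = 0 this forces S = 0. *)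
Lemma cubic_polar (f : Q -> Q -> Q -> V) :
  (forall x x' y z, f (gmul x x') y z = f x y z + f x' y z) ->
  (forall x y y' z, f x (gmul y y') z = f x y z + f x y' z) ->
  (forall x y z z', f x y (gmul z z') = f x y z + f x y z') ->
  (forall x y z, f x y z *+ 3 = 0) -> (forall x, f x x x = 0) ->
  forall x y, f x x y + f x y x + f y x x = 0.
Proof.
move=> f1 f2 f3 t0 f0 x y; pose S x y := f x x y + f x y x + f y x x.
have V1 u v w : f (ginv u) v w = - f u v w by apply: (additiveV (f := fun u => f u v w)).
have V2 u v w : f u (ginv v) w = - f u v w by apply: (additiveV (f := fun v => f u v w)).
have V3 u v w : f u v (ginv w) = - f u v w by apply: (additiveV (f := f u v)).
have Ep : S x y + S y x = 0.
  have := f0 (gmul x y); rewrite !f1 !f2 !f3 !f0 => <-; rewrite /S; abel.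
have En : S y x - S x y = 0.
  have := f0 (gmul x (ginv y)); rewrite !f1 !f2 !f3 !V1 !V2 !V3 !f0 => <-; rewrite /S; abel.
have E3 : S x y *+ 3 = 0 by rewrite /S !mulrnDl !t0 !addr0.
have -> : f x x y + f x y x + f y x x = S x y *+ 3 - (S x y + S y x) + (S y x - S x y).
  rewrite /S; abel.
by rewrite E3 Ep En !(subr0, addr0).
Qed.

End Polarization.

Section WeightFive.
Variables (Q : Grp) (V : zmodType) (Phi : Q -> V).
Hypothesis g6 : forall x : Q, gamma 6 x -> x = 1.
Hypothesis PhiM : forall v w : Q, gamma 5 v -> gamma 5 w -> Phi (v * w) = (Phi v + Phi w)%R.
Hypothesis Phi3 : forall v : Q, gamma 5 v -> (Phi v *+ 3 = 0)%R.
(** In the application [Q] is H / gamma_6 and [Phi] is the power map v |-> v ^ 'C(e, 3). [PhiA] then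
    says that this power of [x, [x, [y, x]]] is central, and [PhiB] that it does not change when x
    is multiplied by an element of [gamma 2]; the quotient in [PhiB] lies in [gamma 5], where [Phi]
    is additive. *)
Hypothesis PhiA : forall z x y, Phi [~ z, [~ x, [~ x, [~ y, x]]]] = 0%R.
Hypothesis PhiB : forall x y u, gamma 2 u ->
  Phi ([~ x * u, [~ x * u, [~ y, x * u]]] * [~ x, [~ x, [~ y, x]]]^-1) = 0%R.

Implicit Types (x y z a b c d e p q u v w : Q).

Let eqg6 v w : eqg 6 v w -> v = w.
Proof. exact: eqg_eq. Qed.

Let Phi1 : Phi 1 = 0%R.
Proof. by apply: (addrI (Phi 1)); rewrite -PhiM ?gmul1 ?addr0 //; exact: gen_one. Qed.

Let F a b c d e := Phi (chain [:: a; b; c; d] e).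

Let chain5 a b c d e : gamma 5 (chain [:: a; b; c; d] e).
Proof. exact: (@chain_gamma Q 1 [:: a; b; c; d] e I). Qed.

Let comm6 i j p q : gamma i p -> gamma j q -> 6 <= i + j -> [~ p, q] = 1.
Proof. by move=> gp gq le; apply/g6/(gamma_leq le)/gamma_comm. Qed.

Let lin_r i j z p q : gamma i p -> gamma j q -> 6 <= i + j.+1 ->
  [~ z, p * q] = [~ z, p] * [~ z, q].
Proof.
move=> gp gq le; rewrite (_ : [~ z, p * q] = [~ z, p] * [~ p, [~ z, q]] * [~ z, q]); last grp.
by rewrite (comm6 gp (gamma_commS z gq)) // gmulr1.
Qed.

Let lin_l x u p : [~ x * u, p] = [~ x, [~ u, p]] * [~ u, p] * [~ x, p].
Proof. grp. Qed.

(** The first variation of [x, [x, [y, x]]]: u replaces each of the three x in turn. Terms with two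
    u, and the corrections for reordering, have weight at least six and vanish. *)
Let sub_expand x y u (a := [~ y, x]) (b := [~ y, u]) : gamma 2 u ->
  [~ x * u, [~ x * u, [~ y, x * u]]] * [~ x, [~ x, a]]^-1 =
  [~ u, [~ x, a]] * ([~ x, [~ u, a]] * [~ x, [~ x, b]]).
Proof.
move=> gu; have ga : gamma 2 a by exact: (@gamma_commS _ 1).
have gb : gamma 3 b by exact: gamma_commS.
have -> : [~ y, x * u] = a * ([~ x, b] * b) by rewrite /a /b; grp.
move: a b ga gb => {y} a b ga gb.
have gxb := gamma_commS x gb; have gc := gamma_mul (gammaS gxb) gb.
have -> : [~ x * u, a * ([~ x, b] * b)] =
    ([~ x, [~ u, a]] * ([~ u, a] * [~ x, a])) * ([~ u, b] * ([~ x, [~ x, b]] * [~ x, b])).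
  rewrite (lin_r _ ga gc) // !lin_l (lin_r x gxb gb) //.
  rewrite (lin_r u gxb gb) // (comm6 gu gxb) // gmul1.
  by rewrite (comm6 (gamma1 x) (gamma_comm gu gb)) // gmul1 !gmulAr.
have gua := gamma_comm gu ga; have gxa := gamma_commS x ga; have gub := gamma_comm gu gb.
have gxua := gamma_commS x gua; have gxxb := gamma_commS x gxb.
have g3 i p : gamma i.+3 p -> gamma 3 p by apply: gamma_leq.
rewrite (@lin_r 3 3) //; first last.
- apply: gamma_mul; [exact: (g3 2)|apply: gamma_mul]; [exact: (g3 2)|]. exact: (g3 1%N _ gxb).
- apply: gamma_mul; [exact: (g3 2)|apply: gamma_mul => //; exact: (g3 1%N)].
rewrite (lin_r _ gxua (@gamma_mul _ 3 _ _ (g3 1%N _ gua) gxa)) // (lin_r _ gua gxa) //.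
rewrite (lin_r _ gub (@gamma_mul _ 3 _ _ (g3 2 _ gxxb) (g3 1%N _ gxb))) // (lin_r _ gxxb gxb) //.
rewrite !lin_l.
have z5 p q : gamma 5 q -> [~ p, q] = 1 by move=> gq; exact: (comm6 (gamma1 p) gq).
rewrite !(z5 _ _ gxua) !(z5 _ _ gub) !(z5 _ _ gxxb) (comm6 gu gua) // (comm6 gu gxb) //.
have gv := gamma_comm gu gxa; rewrite (z5 x _ gv) ?(gcommx1, gmul1, gmulr1).
have cen p q : gamma 5 p -> p * q = q * p by move=> gp; apply/gcomm1P; rewrite -gcommV z5 ?ginv1.
have fin (p q r s : Q) : (forall t, p * t = t * p) -> (forall t, s * t = t * s) ->
    p * (q * r) * s * r^-1 = q * (p * s).
  by move=> pC sC; rewrite !gmulAr (sC r^-1) gmulVKr [LHS]gmulA pC gmulAr.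
by apply: fin => t; exact: cen.
Qed.

Local Open Scope ring_scope.

Let F3 a b c d e : F a b c d e *+ 3 = 0. Proof. exact: Phi3. Qed.

Ltac ab3 := abel_mod 3%N ltac:(by rewrite /= !F3 eqxx).

Let slot l1 x y l2 e : (size l1 + size l2 = 3)%N ->
  Phi (chain (l1 ++ gmul x y :: l2) e) =
  Phi (chain (l1 ++ x :: l2) e) + Phi (chain (l1 ++ y :: l2) e).
Proof.
move=> sz; have sz1 (z : Q) : size (l1 ++ z :: l2) = 4%N by rewrite size_cat /= addnS sz.
have E := @chain_slot Q 1 l1 x y l2 e isT I.
rewrite sz1 in E; rewrite (eqg6 E) PhiM //.
  by have := @chain_gamma Q 1 (l1 ++ x :: l2) e I; rewrite sz1.
by have := @chain_gamma Q 1 (l1 ++ y :: l2) e I; rewrite sz1.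
Qed.

Let F2D a b b' c d e : F a (gmul b b') c d e = F a b c d e + F a b' c d e.
Proof. exact: (@slot [:: a]). Qed.
Let F3D a b c c' d e : F a b (gmul c c') d e = F a b c d e + F a b c' d e.
Proof. exact: (@slot [:: a; b]). Qed.
Let F4D a b c d d' e : F a b c (gmul d d') e = F a b c d e + F a b c d' e.
Proof. exact: (@slot [:: a; b; c]). Qed.
Let F5D a b c d e e' : F a b c d (gmul e e') = F a b c d e + F a b c d e'.
Proof.
by rewrite /F (eqg6 (@chain_mul Q 1 [:: a; b; c; d] e e' isT I I)) PhiM.
Qed.

Let Falt a b c d : F a b c d d = 0.
Proof.
by rewrite /F /= gcommxx !gcommx1 Phi1.
Qed.

Let Fskew a b c d e : F a b c d e + F a b c e d = 0.
Proof.
have := Falt a b c (gmul d e); rewrite F4D !F5D !Falt => <-; abel.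
Qed.

Let jacobi l i j k (a b c : Q) : (0 < k)%N -> (i + j + k + size l = 5)%N ->
  gamma i a -> gamma j b -> gamma k c ->
  Phi (chain l (gcomm a (gcomm b c))) =
  Phi (chain l (gcomm b (gcomm a c))) + Phi (chain l (gcomm (gcomm a b) c)).
Proof.
move=> k0 sz ga gb gc.
have s0 : (0 < i + j + k)%N by lia.
have G1 : gamma (i + j + k) (gcomm b (gcomm a c)).
  have := gamma_comm gb (gamma_comm ga gc); congr gamma; lia.
have G2 := gamma_comm (gamma_comm ga gb) gc.
have := eqg_chain l (eqg_jacobi k0 ga gb gc); rewrite addSn sz => /eqg6 ->.
have := chain_mul l s0 G1 G2; rewrite sz => /eqg6 ->.
by rewrite PhiM // -sz; apply: chain_gamma.
Qed.

Let chain_opp l i (a b : Q) : (0 < i)%N -> (i + size l = 5)%N -> gamma i (gcomm a b) ->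
  Phi (chain l (gcomm a b)) = - Phi (chain l (gcomm b a)).
Proof.
move=> i0 sz gab; have gba : gamma i (gcomm b a) by rewrite -gcommV; apply: gamma_inv.
have := chain_mul l i0 gab gba; rewrite sz => /eqg6.
rewrite -[X in gmul _ X]gcommV gmulVr => E.
have c1 : chain l (gone Q) = gone Q by elim: l {sz E} => //= x l ->; exact: gcommx1.
apply/eqP; rewrite -addr_eq0 -PhiM; first last.
- by rewrite -sz; apply: chain_gamma.
- by rewrite -sz; apply: chain_gamma.
by rewrite -E c1 Phi1.
Qed.

Let FJ3 p q a b c : F p q a b c - F p q b a c + F p q c a b = 0.
Proof.
have E : F p q a b c = F p q b a c + Phi (chain [:: p; q] (gcomm (gcomm a b) c)).
  exact: (@jacobi [:: p; q] 1 1 1).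
rewrite E (@chain_opp [:: p; q] 3 (gcomm a b) c) //; last first.
  exact: (@gamma_comm _ 2 1 _ _ (@gamma_commS _ 1 _ _ I)).
rewrite -/(F p q c a b); abel.
Qed.

(** Antisymmetry of [[a, b], [c, d]], both orders being expanded by Jacobi. *)
Let FJ4 p a b c d : F p a b c d - F p b a c d + F p c d a b - F p d c a b = 0.
Proof.
have g2 x y : gamma 2 (gcomm x y) by exact: (@gamma_commS _ 1).
have E1 : F p a b c d = F p b a c d + Phi (chain [:: p] (gcomm (gcomm a b) (gcomm c d))).
  exact: (@jacobi [:: p] 1 1 2).
have E2 : F p c d a b = F p d c a b + Phi (chain [:: p] (gcomm (gcomm c d) (gcomm a b))).
  exact: (@jacobi [:: p] 1 1 2).
rewrite E1 E2 (@chain_opp [:: p] 4 (gcomm a b)) //; last exact: (@gamma_comm _ 2 2).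
abel.
Qed.

Let Fpair v w a b c :
  Phi (gcomm (gcomm v w) (gcomm a (gcomm b c))) = F v w a b c - F w v a b c.
Proof.
have E : F v w a b c =
    F w v a b c + Phi (gcomm (gcomm v w) (gcomm a (gcomm b c))).
  apply: (@jacobi [::] 1 1 3) => //; do 2!apply: gamma_commS => //.
rewrite E; abel.
Qed.

Let Fpair2 x v w b c :
  Phi (gcomm x (gcomm (gcomm v w) (gcomm b c))) = F x v w b c - F x w v b c.
Proof.
have E : F x v w b c =
    F x w v b c + Phi (chain [:: x] (gcomm (gcomm v w) (gcomm b c))).
  apply: (@jacobi [:: x] 1 1 2) => //; exact: (@gamma_commS _ 1).
rewrite E /=; abel.
Qed.

(** The Jacobi identity for c, [v, w] and [x, y], rewritten in right-normed commutators. *)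
Let FJ5 x y c v w : F x y c v w - F y x c v w + F c v w x y - F c w v x y
  - F v w c x y + F w v c x y = 0.
Proof.
have g2 a b : gamma 2 (gcomm a b) by exact: (@gamma_commS _ 1).
have E := @jacobi [::] 1 2 2 c (gcomm v w) (gcomm x y) isT erefl I (g2 _ _) (g2 _ _).
have O := @chain_opp [::] 5 (gcomm c (gcomm v w)) (gcomm x y) isT erefl
  (@gamma_comm _ 3 2 _ _ (@gamma_commS _ 2 _ _ (g2 _ _)) (g2 _ _)).
rewrite /= in E O; rewrite Fpair2 Fpair O Fpair in E.
move/eqP: E; rewrite -subr_eq0 => /eqP <-; abel.
Qed.

Let S0 z x x' y : F z x x y x' + F z x x' y x + F z x' x y x = 0.
Proof.
apply: (cubic_polar (f := fun a b c => F z a b y c)) => //.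
by move=> a; exact: PhiA.
Qed.

(** Makes [F] alternating in its third and fourth arguments. The bracketed groups are instances of
    [FJ4], [Fskew], [FJ3] and [S0]; the identity holds modulo 3, where the coefficient 2 is -1. *)
Let F_last3 z y x x' : F z y x x x' = 0.
Proof.
have -> : F z y x x x' =
  (F z x x' y x - F z x' x y x + F z y x x x' - F z x y x x')
  + (F z x x' x y + F z x x' y x)
  + (F z x x x' y - F z x x' x y + F z x y x x')
  + (F z x x x' y + F z x x y x') *+ 2
  + (F z x x y x' + F z x x' y x + F z x' x y x).
  by ab3.
by rewrite (FJ4 z x x' y x) (Fskew z x x' x y) (FJ3 z x x x' y) (Fskew z x x x' y)
  (S0 z x x' y) ?(mul0rn, addr0).
Qed.

(** [PhiB] for u = [v, w], with its three terms expanded by Jacobi. *)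
Let B0 x y v w : F v w x y x - F w v x y x + F x v w y x - F x w v y x + F x x y v w = 0.
Proof.
have g2 p q : gamma 2 (gcomm p q) by exact: (@gamma_commS _ 1).
pose u := gcomm v w; have gu : gamma 2 u by exact: g2.
have gb : gamma 3 (gcomm y u) by exact: gamma_commS.
have gxa : gamma 3 (gcomm x (gcomm y x)) by exact: gamma_commS.
have h1 := gamma_comm gu gxa; have h2 := gamma_commS x (gamma_comm gu (g2 y x)).
have h3 := gamma_commS x (gamma_commS x gb).
rewrite -(PhiB x y gu) sub_expand // (PhiM h1 (gamma_mul h2 h3)) (PhiM h2 h3).
rewrite /u Fpair Fpair2 -/(F x x y v w); abel.
Qed.

(* The combination was found by linear algebra over the field with 3 elements. *)
Let F_mid2 y x v w : F y x x v w = 0.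
Proof.
have -> : F y x x v w =
  (F x v w x y - F x w v x y + F x x y v w - F x y x v w)
  + (F v x w y x - F x v w y x + F w y x v x - F w x y v x - F y x w v x + F x y w v x)
  + (F v w x y x - F v x w y x + F v y x w x - F v x y w x)
  + (F v w x y x - F w v x y x + F x v w y x - F x w v y x + F x x y v w)
  + (F v w x y x - F w v x y x + F x y x v w - F x x y v w - F y x x v w + F x y x v w)
  + (F v w x x y - F v x w x y + F v x y w x - F v y x w x)
  + (F v x w x y - F x v w x y + F w x y v x - F w y x v x - F x y w v x + F y x w v x)
  + (F w x v x y - F x w v x y + F v x y w x - F v y x w x - F x y v w x + F y x v w x) *+ 2
  + (F w v x x y - F w x v x y + F w x y v x - F w y x v x) *+ 2
  + (F v w x x y - F w v x x y + F x x y v w - F x y x v w - F x y x v w + F y x x v w) *+ 2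
  + (F w x v y x - F x w v y x + F v y x w x - F v x y w x - F y x v w x + F x y v w x) *+ 2
  + (F w v x y x - F w x v y x + F w y x v x - F w x y v x) *+ 2.
  by ab3.
by rewrite (FJ4 x v w x y) (FJ5 v x w y x) (FJ4 v w x y x) (B0 x y v w) (FJ5 v w x y x)
  (FJ4 v w x x y) (FJ5 v x w x y) (FJ5 w x v x y) (FJ4 w v x x y) (FJ5 v w x x y)
  (FJ5 w x v y x) (FJ4 w v x y x) ?(mul0rn, addr0).
Qed.

Lemma weight5_zero v : gamma 5 v -> Phi v = 0.
Proof.
have sw3 z y a b c : F z y a b c = - F z y b a c.
  have := F_last3 z y (gmul a b) c; rewrite F3D !F4D !F_last3 => E.
  apply/eqP; rewrite -addr_eq0 -E; apply/eqP; abel.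
have sw2 z a b c d : F z a b c d = - F z b a c d.
  have := F_mid2 z (gmul a b) c d; rewrite F2D !F3D !F_mid2 => E.
  apply/eqP; rewrite -addr_eq0 -E; apply/eqP; abel.
have sk z y a b c : F z y a b c = - F z y a c b.
  by apply/eqP; rewrite -addr_eq0 Fskew.
have F0 a b c d e : F a b c d e = 0.
  (* [F] now alternates in its last four arguments, so the four signed terms of [FJ4] are all equal
     to [F a b c d e]: four times this value vanishes, and 4 is 1 modulo 3. *)
  have := FJ4 a b c d e.
  rewrite (sw2 a c b d e) (sw2 a e d b c) (sw3 a d e b c) (sw2 a d b e c) (sk a b d e c).
  rewrite (sw3 a b d c e) => E; rewrite -[RHS]E; ab3.
(* A generator [x, y] of [gamma i.+2] hands x over to the end of the list, so [i] decreases until a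
   right-normed commutator in single elements remains. *)
suff chain0 i l w : (0 < i)%N -> (size l + i = 5)%N -> gamma i w -> Phi (chain l w) = 0.
  exact: (chain0 5 [::]).
elim: i l w => [|[|i] IH] l w // _ sz.
  have {sz} : size l = 4%N by lia.
  by case: l => [|a [|b [|c [|d []]]]] // _ _; exact: F0.
have c1 : Phi (chain l (gone Q)) = 0.
  by rewrite (_ : chain l _ = gone Q) ?Phi1 //; elim: l {sz} => //= x l ->; exact: gcommx1.
have cM x y : gamma i.+2 x -> gamma i.+2 y ->
    Phi (chain l (gmul x y)) = Phi (chain l x) + Phi (chain l y).
  have sz' : (i.+2 + size l = 5)%N by rewrite addnC.
  move=> gx gy; have := @chain_mul _ i.+2 l _ _ isT gx gy; rewrite sz' => /eqg6 ->.
  by rewrite PhiM // -sz'; exact: chain_gamma.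
elim=> {w} [|z [x [y [gy ->]]]|x gx IHx|x y gx IHx gy IHy] //.
- have := IH (rcons l x) y; rewrite /chain foldr_rcons; apply => //.
  by rewrite size_rcons addSnnS.
- by apply: (addIr (Phi (chain l x))); rewrite -cM ?gmulV ?c1 ?IHx ?addr0 //; exact: gen_inv.
- by rewrite cM // IHx IHy addr0.
Qed.

End WeightFive.

(** * Powers in class six *)

Section ClassSix.
Variable H : Grp.
Implicit Types (x y z a b c u v : H) (n m i j : nat).
Local Notation gam i := (@gamma H i).
Hypothesis gam7 : forall x, gam 7 x -> x = 1.

Lemma gamma_commute i j x y : gam i x -> gam j y -> 7 <= i + j -> x * y = y * x.
Proof.
move=> gx gy ij; apply/gcomm1P/gam7; exact: gamma_leq ij (gamma_comm gx gy).
Qed.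

Section Collect.
Variables x a t1 t2 t3 t4 s r p : H.
Hypothesis ga : gam 2 a.
Hypothesis e1 : t1 = [~ x, a].
Hypothesis e2 : t2 = [~ x, t1].
Hypothesis e3 : t3 = [~ x, t2].
Hypothesis e4 : t4 = [~ x, t3].
Hypothesis es : s = [~ a, t1].
Hypothesis er : r = [~ x, s].
Hypothesis ep : p = [~ a, t2].

Let g1 : gam 3 t1. Proof. by rewrite e1; exact: gamma_commS. Qed.
Let g2 : gam 4 t2. Proof. by rewrite e2; exact: gamma_commS. Qed.
Let g3 : gam 5 t3. Proof. by rewrite e3; exact: gamma_commS. Qed.
Let g4 : gam 6 t4. Proof. by rewrite e4; exact: gamma_commS. Qed.
Let gs : gam 5 s. Proof. by rewrite es; exact: (gamma_comm ga g1). Qed.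
Let gr : gam 6 r. Proof. by rewrite er; exact: gamma_commS. Qed.
Let gp : gam 6 p. Proof. by rewrite ep; exact: (gamma_comm ga g2). Qed.

Let central z y : gam 6 z -> z * y = y * z.
Proof. by move=> gz; apply: (gamma_commute gz (gamma1 y)). Qed.

(** Collected form: through weight six no further commutators of a and x arise. [A5] to [A2] are
    named after the binomials 'C(n, 5) to 'C(n, 2) that they become. Left multiplication by a ([aM])
    and conjugation by x ([cjMon]) act on the exponents by Pascal-type recurrences. *)
Let M (A5 A4 A3 A2 N f g h : nat) :=
  t4 ^+ A5 * (t3 ^+ A4 * (t2 ^+ A3 * (t1 ^+ A2 * (a ^+ N *
    (s ^+ f * (r ^+ g * p ^+ h)))))).

Let commpow i j n y z : gam i y -> gam j z -> 7 <= i + j -> y * z ^+ n = z ^+ n * y.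
Proof. by move=> gy gz ij; apply/gcommute_pow/(gamma_commute gy gz ij). Qed.

Let swapa y z (c : H) n : a * y = y * c * a -> gam 5 c -> gam 3 y ->
  a * (y ^+ n * z) = y ^+ n * (c ^+ n * (a * z)).
Proof.
move=> E gc gy; elim: n z => [|n IH] z; first grp.
rewrite !gpowS !gmulAr gmulA E !gmulAr IH; congr (_ * _).
by rewrite gmulA (gamma_commute gc (gamma_pow n gy)) // gmulAr.
Qed.

Let aM A5 A4 A3 A2 N f g h :
  a * M A5 A4 A3 A2 N f g h = M A5 A4 A3 A2 N.+1 (f + A2) g (h + A3).
Proof.
rewrite /M gmulA (commpow _ ga g4) // gmulAr; congr (_ * _).
rewrite gmulA (commpow _ ga g3) // gmulAr; congr (_ * _).
rewrite (@swapa _ _ p); first last.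
- exact: gammaS g2.
- exact: gammaS gp.
- by rewrite -(central t2 gp) ep; grp.
congr (_ * _).
rewrite (@swapa _ _ s) //; last by rewrite -(gamma_commute gs g1) // es; grp.
rewrite -[RHS]gmulAr.
have -> : p ^+ A3 * (t1 ^+ A2 * (s ^+ A2 * (a * (a ^+ N * (s ^+ f * (r ^+ g * p ^+ h)))))) =
  t1 ^+ A2 * (s ^+ A2 * (a * (a ^+ N * (s ^+ f * (r ^+ g * p ^+ h))))) * p ^+ A3.
  by rewrite central //; exact: gamma_pow.
rewrite gpowS !gmulAr; congr (_ * _); rewrite gmulA.
rewrite (gamma_commute (gamma_pow A2 gs) ga) // gmulAr; congr (_ * _).
rewrite gmulA (gamma_commute (gamma_pow A2 gs) (gamma_pow N ga)) // gmulAr.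
by rewrite !gpowD [s ^+ f * s ^+ A2](gamma_commute (gamma_pow f gs) (gamma_pow A2 gs)) // !gmulAr.
Qed.

Let powta n : (t1 * a) ^+ n = t1 ^+ n * (a ^+ n * s ^+ 'C(n, 2)).
Proof.
elim: n => [|n IH]; first grp.
rewrite gpowS IH binS bin1 gpowD !gpowS.
rewrite !gmulAr (@swapa _ _ s) //; last by rewrite -(gamma_commute gs g1) // es; grp.
congr (_ * _); congr (_ * _).
rewrite gmulA (gamma_commute (gamma_pow n gs) ga) // !gmulAr; congr (_ * _).
rewrite gmulA (gamma_commute (gamma_pow n gs) (gamma_pow n ga)) // gmulAr.
by rewrite (gamma_commute (gamma_pow n gs) (gamma_pow _ gs)).
Qed.

Let cj z := x * z * x^-1.
Let cjM y z : cj (y * z) = cj y * cj z. Proof. rewrite /cj; grp. Qed.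
Let cjX y n : cj (y ^+ n) = (cj y) ^+ n. Proof. by rewrite /cj gpow_conj. Qed.
Let cjE y : cj y = [~ x, y] * y. Proof. by rewrite /cj gconjE. Qed.

Let cjMon A5 A4 A3 A2 N f g h :
  cj (M A5 A4 A3 A2 N f g h) =
  M (A5 + A4) (A4 + A3) (A3 + A2) (A2 + N) N (f + 'C(N, 2)) (g + f) h.
Proof.
rewrite /M !cjM !cjX !cjE.
have c6 z : gam 6 z -> [~ x, z] = 1 by move=> gz; apply/gam7/gamma_commS.
rewrite (c6 t4) // (c6 r) // (c6 p) // !gmul1.
rewrite -e4 -e3 -e2 -e1 -er.
rewrite (gpowMn _ (gamma_commute g4 g3 _)) // (gpowMn _ (gamma_commute g3 g2 _)) //.
rewrite (gpowMn _ (gamma_commute g2 g1 _)) // (gpowMn _ (gamma_commute gr gs _)) //.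
rewrite powta !gpowD !gmulAr; do 9! congr (_ * _).
rewrite [r ^+ f * _]gmulA (gamma_commute (gamma_pow f gr) (gamma_pow f gs)) // gmulAr.
rewrite [LHS]gmulA (gamma_commute (gamma_pow _ gs) (gamma_pow f gs)) // gmulAr.
do 2! congr (_ * _).
by rewrite gmulA (gamma_commute (gamma_pow f gr) (gamma_pow g gr)) // gmulAr.
Qed.

(** If (a x)^n = m(n) x^n, then m(n + 1) = a (x m(n) x^-1). The exponents solve the resulting
    recurrence: that of s grows by 'C(n, 2) + 'C(n + 1, 2), that of r by the exponent of s, that of
    p by 'C(n + 1, 3). *)
Lemma power_collect n : (a * x) ^+ n =
  t4 ^+ 'C(n, 5) * (t3 ^+ 'C(n, 4) * (t2 ^+ 'C(n, 3) * (t1 ^+ 'C(n, 2) * (a ^+ n *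
    (s ^+ ('C(n, 3) + 'C(n.+1, 3)) *
     (r ^+ ('C(n, 4) + 'C(n.+1, 4)) * p ^+ 'C(n.+1, 4))))))) * x ^+ n.
Proof.
pose m n := M 'C(n, 5) 'C(n, 4) 'C(n, 3) 'C(n, 2) n ('C(n, 3) + 'C(n.+1, 3))
  ('C(n, 4) + 'C(n.+1, 4)) 'C(n.+1, 4).
rewrite -/(M _ _ _ _ _ _ _ _) -/(m n); elim: n => [|n IH]; first by rewrite /m /M /=; grp.
have -> : m n.+1 = a * cj (m n).
  rewrite /m cjMon aM !binS !bin1 ?bin0; congr M; lia.
by rewrite gpowS IH /cj gpowS; grp.
Qed.

End Collect.
End ClassSix.

Lemma gcomm_pow (G : Grp) (z v : G) n : [~ z, v] * v = v * [~ z, v] ->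
  [~ z, v ^+ n] = [~ z, v] ^+ n.
Proof.
move=> C; elim: n => [|n IH]; first exact: gcommx1.
rewrite gpowS (_ : [~ z, v * v ^+ n] = [~ z, v] * (v * [~ z, v ^+ n] * v^-1)); last grp.
by rewrite IH -gpow_conj -[v * _]C gmulAr gmulVr gmulr1.
Qed.

Lemma gcommuteV (G : Grp) (z v : G) : z * v = v * z -> z * v^-1 = v^-1 * z.
Proof.
move=> C; apply: (@gmulIr _ v); apply: (@gmul_cancel _ v).
by rewrite gmulAr gmulV gmulr1 gmulAr gmulVKr.
Qed.

Lemma eqg_comm_l (G : Grp) i j (x u v : G) : gamma i u -> gamma j v ->
  eqg (i + j) [~ x * u, v] [~ x, v].
Proof.
move=> gu gv; rewrite /eqg (_ : _ * _ = [~ x, [~ u, v]] * [~ u, v]); last grp.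
have guv := gamma_comm gu gv; apply: gamma_mul => //; exact/gammaS/gamma_commS.
Qed.

(** * Class six with central e-th powers: torsion in weights three to five *)

Section ClassSixExponent.
Variables (H : Grp) (e : nat).
Implicit Types (x y z a b c u v w : H) (n m i j : nat).
Local Notation gam i := (@gamma H i).
Hypothesis gam7 : forall x, gam 7 x -> x = 1.
Hypothesis oe : odd e.
Hypothesis cen : forall x y, x ^+ e * y = y * x ^+ e.
Local Notation k := ('C(e, 3)).

Lemma conj_pow x y : ([~ y, x] * x) ^+ e = x ^+ e.
Proof. by rewrite -gconjE gpow_conj -cen gmulAr gmulVr gmulr1. Qed.

Lemma gamma_commute1 i j x y : gam i x -> gam j y -> 7 <= i + j -> [~ x, y] = 1.
Proof. by move=> gx gy ij; apply/gcomm1P; apply: (gamma_commute gam7 gx gy). Qed.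

(** For u in [gamma 3] the elements u and [y, u] commute, their weights adding up to 7, so
    [conj_pow] reads [y, u]^e u^e = u^e. *)
Lemma gamma4_exp v : gam 4 v -> v ^+ e = 1.
Proof.
move: v; apply: gamma_ind => [|y u gu|x _ IHx|x y gx IHx gy IHy].
- exact: gpow1n.
- have ga : gam 4 [~ y, u] by exact: gamma_commS.
  have := conj_pow u y; rewrite gpowMn; last by apply: (gamma_commute gam7 ga gu).
  by rewrite -[RHS]gmul1 => /gmulIr.
- by rewrite gpowV IHx ginv1.
- by rewrite gpowMn ?IHx ?IHy ?gmul1 //; apply: (gamma_commute gam7 gx gy).
Qed.

Lemma gamma4_pow v n : e %| n -> gam 4 v -> v ^+ n = 1.
Proof. by move=> en /gamma4_exp/gpow_dvd; apply. Qed.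

Lemma collect_short x a n : gam 2 a -> [~ x, [~ x, a]] = 1 -> [~ a, [~ x, a]] = 1 ->
  (a * x) ^+ n = [~ x, a] ^+ 'C(n, 2) * a ^+ n * x ^+ n.
Proof.
move=> ga t2 s; rewrite (power_collect gam7 ga erefl erefl erefl erefl erefl erefl erefl n).
by rewrite !s !t2 !gcommx1 !gpow1n !gmul1 !gmulr1.
Qed.

(** For u in [gamma 2] collection leaves one correction, [u, [y, u]] ^ 'C(e, 2), which dies because
    it lies in [gamma 4] and e divides 'C(e, 2). *)
Lemma gamma3_exp v : gam 3 v -> v ^+ e = 1.
Proof.
have [e2 _ _ _] := dvdn_bin_odd oe.
move: v; apply: gamma_ind => [|y u gu|x _ IHx|a b ga IHa gb IHb].
- exact: gpow1n.
- have ga : gam 3 [~ y, u] by exact: gamma_commS.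
  have g1 := gamma_comm gu ga; have := conj_pow u y; rewrite collect_short; first last.
  + exact: gamma_commute1 ga g1 _.
  + exact: gamma_commute1 gu g1 _.
  + exact: gammaS.
  by rewrite (gamma4_pow e2 (gammaS g1)) gmul1 -[RHS]gmul1 => /gmulIr.
- by rewrite gpowV IHx ginv1.
- have g1 := gamma_comm gb ga; rewrite collect_short; first last.
  + exact: gamma_commute1 ga g1 _.
  + exact: gamma_commute1 gb g1 _.
  + exact: gammaS.
  by rewrite (gamma4_pow e2) ?IHa ?IHb ?gmul1 //; apply: gamma_leq g1.
Qed.

Lemma gamma3_pow v n : e %| n -> gam 3 v -> v ^+ n = 1.
Proof. by move=> en /gamma3_exp/gpow_dvd; apply. Qed.

Lemma collect_e x a : gam 2 a ->
  (a * x) ^+ e = [~ x, [~ x, [~ x, [~ x, a]]]] ^+ 'C(e, 5) * ([~ x, [~ x, a]] ^+ k *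
    (a ^+ e * ([~ a, [~ x, a]] ^+ (k + k) *
      ([~ x, [~ a, [~ x, a]]] ^+ k * [~ a, [~ x, [~ x, a]]] ^+ k)))) * x ^+ e.
Proof.
move=> ga; have [e2 e4 _ _] := dvdn_bin_odd oe.
rewrite (power_collect gam7 ga erefl erefl erefl erefl erefl erefl erefl e).
have g1 := gamma_commS x ga; have g2 := gamma_commS x g1; have g3 := gamma_commS x g2.
have gs := gamma_comm ga g1; have gr := gamma_commS x gs; have gp := gamma_comm ga g2.
rewrite (gamma3_pow e2 g1) (gamma4_pow e4 (gammaS g3)) !gmul1.
have -> : [~ a, [~ x, a]] ^+ ('C(e, 3) + 'C(e.+1, 3)) = [~ a, [~ x, a]] ^+ (k + k).
  by rewrite binS addnA gpowD (gamma4_pow e2 (gammaS gs)) gmulr1.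
have E v : gam 4 v -> v ^+ 'C(e.+1, 4) = v ^+ k.
  by move=> gv; rewrite binS gpowD (gamma4_pow e4 gv) gmul1.
have gr4 := gammaS (gammaS gr).
by rewrite [_ ^+ ('C(e, 4) + _)]gpowD (gamma4_pow e4 gr4) gmul1 (E _ gr4)
  (E _ (gammaS (gammaS gp))).
Qed.

Lemma gamma_pow_hom v w n : gam 4 v -> gam 4 w -> (v * w) ^+ n = v ^+ n * w ^+ n.
Proof. by move=> gv gw; apply: gpowMn; apply: (gamma_commute gam7 gv gw). Qed.

Section TorsionSix.
(** Used twice: in H / gamma_6, where it is void, in order to prove it for H, and then in H
    itself. *)
Hypothesis h6 : forall v, gam 6 v -> v ^+ k = 1.

Lemma commutator_rel x y a : a = [~ y, x] ->
  [~ x, [~ x, [~ x, [~ x, a]]]] ^+ 'C(e, 5) * ([~ x, [~ x, a]] ^+ k *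
    (a ^+ e * [~ a, [~ x, a]] ^+ (k + k))) = 1.
Proof.
move=> Ea; have ga : gam 2 a by rewrite Ea; exact: (@gamma_commS _ 1).
have g1 := gamma_commS x ga; have g2 := gamma_commS x g1.
have gr := gamma_commS x (gamma_comm ga g1); have gp := gamma_comm ga g2.
have := conj_pow x y; rewrite -Ea collect_e // (h6 gr) (h6 gp) !gmulr1.
by rewrite -[RHS]gmul1 => /gmulIr.
Qed.

Lemma gamma2_mul_pow a b : gam 2 a -> gam 2 b -> (a * b) ^+ e = a ^+ e * b ^+ e.
Proof.
move=> ga gb; rewrite collect_e //.
have g1 := gamma_comm gb ga; have g2 := gamma_comm gb g1; have gs := gamma_comm ga g1.
have z3 x : [~ x, [~ b, [~ b, a]]] = 1 by exact: gamma_commute1 (gamma1 x) g2 _.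
have z2 : [~ b, [~ a, [~ b, a]]] = 1 by exact: gamma_commute1 (gamma1 b) gs _.
by rewrite !z3 z2 gcommx1 gpowD (h6 g2) (h6 gs) !gpow1n !gmul1 !gmulr1.
Qed.

(** The commutator equals [z, t ^ k] with t = [x, [x, [y, x]]], and [commutator_rel] writes t ^ k
    through factors commuting with z: an element of [gamma 6], an e-th power, and a power of s, for
    which [z, s] ^ (k + k) = 1 by [h6]. *)
Lemma third_comm_pow z x y : [~ z, [~ x, [~ x, [~ y, x]]]] ^+ k = 1.
Proof.
set t := [~ x, [~ x, _]].
have gt : gam 4 t by do 3!apply: (@gamma_commS); exact: gamma1.
have gzt := gamma_commS z gt.
rewrite -gcomm_pow; last by apply: (gamma_commute gam7 gzt gt).
have := commutator_rel (erefl [~ y, x]); rewrite -/t.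
set a := [~ y, x]; set s := [~ a, _]; set q := [~ x, [~ x, t]].
have ga : gam 2 a by exact: (@gamma_commS _ 1).
have gs : gam 5 s by exact: (gamma_comm ga (gamma_commS x ga)).
have gq : gam 6 q by do 2!apply: gamma_commS.
have zs : [~ z, s ^+ (k + k)] = 1.
  have gzs := gamma_commS z gs.
  rewrite gcomm_pow; last by apply: (gamma_commute gam7 gzs gs).
  by rewrite gpowD !h6 // gmul1.
have zq : [~ z, q ^+ 'C(e, 5)] = 1 by exact: gamma_commute1 (gamma1 z) (gamma_pow _ gq) _.
have za : [~ z, a ^+ e] = 1 by apply/gcomm1P; rewrite cen.
move: (q ^+ _) (t ^+ _) (a ^+ _) (s ^+ _) zq za zs =>
  q' t' a' s' /gcomm1P zq /gcomm1P za /gcomm1P zs E.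
have -> : t' = q'^-1 * (a' * s')^-1.
  by apply: (@gmulIr _ (a' * s')); apply: (@gmul_cancel _ q'); rewrite E; grp.
apply/gcomm1P; rewrite gmulA (gcommuteV zq) !gmulAr; congr (_ * _); apply: gcommuteV.
by rewrite gmulA za !gmulAr zs.
Qed.

Lemma gamma5_congr_pow v w : gam 5 v -> eqg 6 w v -> w ^+ k = v ^+ k.
Proof.
move=> gv gwv; have -> : w = w * v^-1 * v by grp.
by rewrite (gamma_pow_hom _ (gammaS (gammaS gwv)) (gammaS gv)) (h6 gwv) gmul1.
Qed.

(** Every other factor of [commutator_rel] is unchanged when x becomes x u: the weight six chain
    because [gamma 7] is trivial, a ^ e because a changes by a factor in [gamma 3], which has
    exponent dividing e, and the power of [a, [x, a]] because this element is constant modulo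
    [gamma 6]. *)
Lemma third_comm_shift x y u : gam 2 u ->
  eqg 5 [~ x * u, [~ x * u, [~ y, x * u]]] [~ x, [~ x, [~ y, x]]] /\
  [~ x * u, [~ x * u, [~ y, x * u]]] ^+ k = [~ x, [~ x, [~ y, x]]] ^+ k.
Proof.
move=> gu; have gyx z z' : gam 2 [~ z, z'] by exact: (@gamma_commS _ 1).
set a' := [~ y, x * u]; set a := [~ y, x].
have shift i z v w : gam i v -> eqg i.+1 v w -> eqg i.+2 [~ x * u, v] [~ x, w].
  by move=> gv vw; apply: eqg_trans (eqg_comm_l _ gu gv) _; exact: eqg_comm.
have gc : gam 3 (x * [~ y, u] * x^-1) by apply: gamma_conj; exact: gamma_commS.
have Ea : a' = a * (x * [~ y, u] * x^-1) by rewrite /a' /a; grp.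
have E0 : eqg 3 a' a.
  by rewrite /eqg Ea; exact: gamma_conj.
have ga' : gam 2 a' by exact: gyx. have ga : gam 2 a by exact: gyx.
have E1 := shift 2 x _ _ ga' E0; have g1' := gamma_commS (x * u) ga'.
have E2 := shift 3 x _ _ g1' E1; have g2' := gamma_commS (x * u) g1'.
have E3 := shift 4 x _ _ g2' E2; have g3' := gamma_commS (x * u) g2'.
have E4 := shift 5 x _ _ g3' E3.
have g := gamma_comm gc ga.
have ae : a' ^+ e = a ^+ e.
  rewrite Ea collect_short //; first last.
  - by apply: (gamma_commute1 ga g).
  - by apply: (gamma_commute1 gc g).
  have [e2 _ _ _] := dvdn_bin_odd oe.
  by rewrite (gamma3_exp gc) (gamma4_pow e2 (gammaS g)) gmul1 gmulr1.
have gs := gamma_comm ga (gamma_commS x ga).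
have ss : eqg 6 [~ a', [~ x * u, a']] [~ a, [~ x, a]].
  apply: (@eqg_trans _ _ [~ a, [~ x * u, a']]); last exact: (eqg_comm_gamma ga E1).
  by rewrite {1}Ea; exact: eqg_comm_l gc g1'.
split; first exact: E2.
have R := commutator_rel (erefl a); have R' := commutator_rel (erefl a').
have qq : [~ x * u, [~ x * u, [~ x * u, [~ x * u, a']]]] = [~ x, [~ x, [~ x, [~ x, a]]]].
  exact: eqg_eq gam7 E4.
have S2 : [~ a', [~ x * u, a']] ^+ (k + k) = [~ a, [~ x, a]] ^+ (k + k).
  by rewrite !gpowD (gamma5_congr_pow gs ss).
rewrite qq ae S2 -R in R'.
by move/gmul_cancel/gmulIr: R'.
Qed.

(** The k-th power map descends to H / gamma_6 on [gamma 5] by [h6], and takes values in the abelian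
    group [gamma 4]. It is killed by 3 since e divides 3 k, so [weight5_zero] applies to it. *)
Lemma gamma5_pow_torsion v : gam 5 v -> v ^+ k = 1.
Proof.
have C4 (p q : H) : gam 4 p -> gam 4 q -> p * q = q * p.
  by move=> gp gq; apply: (gamma_commute gam7 gp gq).
have [Q [f [fM surj fker]]] := gamma_quotient H 6.
have [lift liftK] := choice surj.
pose Phi q : abgamma C4 := to_ab C4 (lift q ^+ k).
have fE p q : f p = f q -> eqg 6 p q.
  by move=> E; apply/fker; rewrite fM (homV fM) E gmulVr.
have PhiE p : gam 5 p -> Phi (f p) = to_ab C4 (p ^+ k).
  move=> gp; rewrite /Phi; congr to_ab; apply: gamma5_congr_pow gp _.
  by apply: fE; rewrite liftK.
have lift5 q : gamma 5 q -> exists2 p, gam 5 p & f p = q by exact: hom_gamma_surj.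
have gX p : gam 5 p -> gam 4 (p ^+ k) by move=> gp; apply/gamma_pow/gammaS.
have [_ _ e3 _] := dvdn_bin_odd oe.
move=> gv; apply: (to_ab_eq0 (gC := C4)); first exact: gX.
rewrite -PhiE //; apply: (weight5_zero (Phi := Phi)).
- by move=> q /(hom_gamma_surj fM surj)[p /fker + <-]; apply.
- move=> _ _ /lift5[p gp <-] /lift5[q gq <-].
  rewrite -fM !PhiE //; last exact: gamma_mul.
  by rewrite (gamma_pow_hom _ (gammaS gp) (gammaS gq)) to_abM //; exact: gX.
- move=> _ /lift5[p gp <-]; rewrite PhiE // -to_abX; last exact: gX.
  by rewrite -gpowM mulnC (gamma4_pow e3 (gammaS gp)) to_ab1.
- move=> z x y; case: (surj z) (surj x) (surj y) => {}z <- [{}x <-] [{}y <-].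
  rewrite -!(homR fM) PhiE ?third_comm_pow ?to_ab1 //.
  by do 3!apply: gamma_commS; exact: (@gamma_commS _ 1).
- move=> x y u gu; case: (surj x) (surj y) (hom_gamma_surj fM surj gu) =>
    {}x <- [{}y <-] [{gu}u gu <-].
  have [E Ek] := third_comm_shift x y gu.
  have g4 (a b c d : H) : gam 4 [~ a, [~ b, [~ c, d]]].
    by do 2!apply: gamma_commS; exact: (@gamma_commS _ 1).
  rewrite -fM -!(homR fM) -(homV fM) -fM PhiE // gamma_pow_hom //; last exact: gamma_inv.
  by rewrite gpowV Ek gmulVr to_ab1.
- exact: (hom_gamma fM gv).
Qed.

End TorsionSix.
End ClassSixExponent.

(** * Forms invariant under y |-> y x^j *)

Section DiagonalInvariance.
Variables (Q : Grp) (V : zmodType).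
Local Open Scope ring_scope.
Implicit Types x y : Q.

(* The moduli 3 and 5 below make the sum over 0 < j < p of j ^ i equal to -1 for i = p - 1
   and to 0 for 0 < i < p - 1, which isolates the term of top degree in [x]. *)
Lemma quadratic_invariant (f : Q -> Q -> V) x y :
  (forall a a' b, f (gmul a a') b = f a b + f a' b) ->
  (forall a b b', f a (gmul b b') = f a b + f a b') ->
  (forall a b, f a b *+ 3 = 0) ->
  (forall j h, h = gpow x j -> f (gmul y h) (gmul y h) = f y y) -> f x x = 0.
Proof.
move=> f1 f2 t inv.
have X1 n h u : h = gpow x n -> f h u = f x u *+ n.
  elim: n h => [_ ->|n IH _ ->]; first exact: (additive1 (f := f^~ u)).
  by rewrite gpowS f1 (IH _ erefl) mulrS.
have X2 n h u : h = gpow x n -> f u h = f u x *+ n.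
  elim: n h => [_ ->|n IH _ ->]; first exact: (additive1 (f := f u)).
  by rewrite gpowS f2 (IH _ erefl) mulrS.
(* Naming the powers hides their head [gmul] from the additivity rewrites. *)
have [h1 H1] : exists h, h = gpow x 1%N by eexists.
have [h2 H2] : exists h, h = gpow x 2%N by eexists.
have := congr2 +%R (inv _ _ H1) (inv _ _ H2).
rewrite !(f1, f2) !(X1 _ _ _ H1, X1 _ _ _ H2) !(X2 _ _ _ H1, X2 _ _ _ H2).
move/eqP; rewrite -subr_eq0 => /eqP E; rewrite -[RHS]oppr0 -E.
abel_mod 3%N ltac:(by rewrite /= !t eqxx).
Qed.

Lemma quartic_invariant (f : Q -> Q -> Q -> Q -> V) x y :
  (forall a a' b c d, f (gmul a a') b c d = f a b c d + f a' b c d) ->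
  (forall a b b' c d, f a (gmul b b') c d = f a b c d + f a b' c d) ->
  (forall a b c c' d, f a b (gmul c c') d = f a b c d + f a b c' d) ->
  (forall a b c d d', f a b c (gmul d d') = f a b c d + f a b c d') ->
  (forall a b c d, f a b c d *+ 5 = 0) ->
  (forall j h, h = gpow x j -> f (gmul y h) (gmul y h) (gmul y h) (gmul y h) = f y y y y) ->
  f x x x x = 0.
Proof.
move=> f1 f2 f3 f4 t inv.
have X1 n h u v w : h = gpow x n -> f h u v w = f x u v w *+ n.
  elim: n h => [_ ->|n IH _ ->]; first exact: (additive1 (f := fun z => f z u v w)).
  by rewrite gpowS f1 (IH _ erefl) mulrS.
have X2 n h u v w : h = gpow x n -> f u h v w = f u x v w *+ n.
  elim: n h => [_ ->|n IH _ ->]; first exact: (additive1 (f := fun z => f u z v w)).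
  by rewrite gpowS f2 (IH _ erefl) mulrS.
have X3 n h u v w : h = gpow x n -> f u v h w = f u v x w *+ n.
  elim: n h => [_ ->|n IH _ ->]; first exact: (additive1 (f := fun z => f u v z w)).
  by rewrite gpowS f3 (IH _ erefl) mulrS.
have X4 n h u v w : h = gpow x n -> f u v w h = f u v w x *+ n.
  elim: n h => [_ ->|n IH _ ->]; first exact: (additive1 (f := f u v w)).
  by rewrite gpowS f4 (IH _ erefl) mulrS.
have E n h : h = gpow x n -> f (gmul y h) (gmul y h) (gmul y h) (gmul y h) - f y y y y =
  (f x y y y + f y x y y + f y y x y + f y y y x) *+ n +
  (f x x y y + f x y x y + f x y y x + f y x x y + f y x y x + f y y x x) *+ n *+ n +
  (f x x x y + f x x y x + f x y x x + f y x x x) *+ n *+ n *+ n +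
  f x x x x *+ n *+ n *+ n *+ n.
  move=> Eh; rewrite !mulrnDl -!(X1 _ _ _ _ _ Eh, X2 _ _ _ _ _ Eh,
    X3 _ _ _ _ _ Eh, X4 _ _ _ _ _ Eh).
  by rewrite !f1 !f2 !f3 !f4; abel.
have Z n := etrans (esym (E n _ erefl)) (etrans (congr1 (+%R^~ _) (inv n _ erefl)) (subrr _)).
have := congr2 +%R (congr2 +%R (Z 1%N) (Z 2%N)) (congr2 +%R (Z 3%N) (Z 4%N)).
rewrite !addr0 => S; rewrite -[RHS]oppr0 -S.
abel_mod 5%N ltac:(by rewrite /= !t eqxx).
Qed.

End DiagonalInvariance.

(** * Exponent of the derived subgroup in class six *)

Section ClassSixFinal.
Variables (H : Grp) (e : nat).
Implicit Types (x y z a b c u v w : H) (l : seq H) (n m i j : nat).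
Local Notation gam i := (@gamma H i).
Hypothesis gam7 : forall x, gam 7 x -> x = 1.
Hypothesis oe : odd e.
Hypothesis cen : forall x y, x ^+ e * y = y * x ^+ e.
Local Notation k := ('C(e, 3)).

(** In H / gamma_6 the hypothesis on weight six is void, so u ^ k lies in [gamma 6] for u in
    [gamma 5]; then [y, u] ^ k = [y, u ^ k] = 1. *)
Lemma gamma6_pow v : gam 6 v -> v ^+ k = 1.
Proof.
have [Q [f [fM surj fker]]] := gamma_quotient H 6.
have g6Q (q : Q) : gamma 6 q -> q = 1.
  by case/(hom_gamma_surj fM surj) => p /fker + <-.
have cenQ (p q : Q) : p ^+ e * q = q * p ^+ e.
  by case: (surj p) (surj q) => {}p <- [{}q <-]; rewrite -(homX fM) -!fM cen.
have h5 u : gam 5 u -> gam 6 (u ^+ k).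
  move=> gu; apply/fker; rewrite (homX fM); apply: gamma5_pow_torsion oe cenQ _ _ _.
  - by move=> q /gammaS; exact: g6Q.
  - by move=> q /g6Q ->; exact: gpow1n.
  - exact: (hom_gamma fM gu).
move: v; apply: gamma_ind => [|y u gu|x _ IHx|x y gx IHx gy IHy].
- exact: gpow1n.
- rewrite -gcomm_pow; last by apply: (gamma_commute gam7 (gamma_commS y gu) gu).
  by apply: (gamma_commute1 gam7 (gamma1 y) (h5 u gu)).
- by rewrite gpowV IHx ginv1.
- by rewrite gpowMn ?IHx ?IHy ?gmul1 //; apply: (gamma_commute gam7 gx gy).
Qed.

Lemma gamma5_pow v : gam 5 v -> v ^+ k = 1.
Proof. exact: (gamma5_pow_torsion gam7 oe cen gamma6_pow). Qed.

Section TopDegree.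
Variables m N : nat.
(** Used with (m, N) = (2, 5 'C(e, 3)) and (4, 3 'C(e, 5)). The bound on m places weight m + 2
    inside the abelian group [gamma 4], and [hN] makes the N-th power depend only on the class
    modulo the next weight. *)
Hypothesis m2 : 1 < m.
Hypothesis hN : forall v, gam m.+3 v -> v ^+ N = 1.

Let congr_pow v w : gam m.+2 v -> eqg m.+3 w v -> w ^+ N = v ^+ N.
Proof.
move=> gv gwv; have -> : w = w * v^-1 * v by grp.
have [g1 g2] : gam 4 (w * v^-1) /\ gam 4 v.
  by split; [apply: gamma_leq gwv | apply: gamma_leq gv]; lia.
by rewrite (gamma_pow_hom gam7 _ g1 g2) (hN gwv) gmul1.
Qed.

Lemma gamma4_comm v w : gam 4 v -> gam 4 w -> v * w = w * v.
Proof. by move=> gv gw; apply: (gamma_commute gam7 gv gw). Qed.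

Let val l w : abgamma gamma4_comm := to_ab gamma4_comm (chain l w ^+ N).

Let chain_m l w : size l = m -> gam 2 w -> gam m.+2 (chain l w).
Proof. by move=> sz /(chain_gamma l); rewrite sz addnC addn2. Qed.

Let to4 v : gam m.+2 v -> gam 4 v.
Proof. by apply: gamma_leq; lia. Qed.

Lemma top_slot l1 x y l2 w : (size l1 + size l2).+1 = m -> gam 2 w ->
  (val (l1 ++ gmul x y :: l2) w = val (l1 ++ x :: l2) w + val (l1 ++ y :: l2) w)%R.
Proof.
move=> sz gw; have szz z : size (l1 ++ z :: l2) = m by rewrite size_cat /= addnS.
have gx := chain_m (szz x) gw; have gy := chain_m (szz y) gw.
rewrite /val -to_abM; [|exact/gamma_pow/to4|exact/gamma_pow/to4].
rewrite -(gamma_pow_hom gam7 _ (to4 gx) (to4 gy)); congr to_ab; apply: congr_pow.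
  exact: gamma_mul.
by have := @chain_slot _ 2 l1 x y l2 w isT gw; rewrite szz addnC addn2.
Qed.

Lemma top_inv l w : size l = m -> gam 2 w ->
  chain l w ^+ N = 1 -> chain l w^-1 ^+ N = 1.
Proof.
move=> sz gw E; have gw' := gamma_inv gw.
have := @chain_mul _ 2 l w^-1 w isT gw' gw; rewrite gmulV sz addnC addn2 => /eqg_sym.
have -> : chain l 1 = 1 by elim: l {sz E} => //= x l ->; exact: gcommx1.
move/congr_pow; rewrite gpow1n => /(_ (gamma_one _ _)).
by rewrite (gamma_pow_hom gam7 _ (to4 (chain_m sz gw')) (to4 (chain_m sz gw))) E gmulr1.
Qed.

End TopDegree.

Lemma gamma5_rel x y n :
  chain [:: x; x; x; x] [~ y, x] ^+ ('C(e, 5) * n) *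
    chain [:: x; x] [~ y, x] ^+ (k * n) * [~ y, x] ^+ (e * n) = 1.
Proof.
have R := commutator_rel gam7 oe cen gamma6_pow (erefl [~ y, x]).
have ga : gam 2 [~ y, x] by exact: (@gamma_commS _ 1).
have gs := gamma_comm ga (gamma_commS x ga).
have g4 : gam 4 (chain [:: x; x] [~ y, x]) by do 2!apply: gamma_commS.
have g6 : gam 6 (chain [:: x; x; x; x] [~ y, x]) by do 2!apply: gamma_commS.
have s1 : [~ [~ y, x], [~ x, [~ y, x]]] ^+ (k + k) = 1.
  by rewrite gpowD (gamma5_pow gs) gmul1.
rewrite s1 gmulr1 -/(chain [:: x; x] _) -/(chain [:: x; x; x; x] _) gmulA in R.
rewrite !gpowM -(gamma_pow_hom gam7); [|exact/gamma_pow/gammaS/gammaS|exact: gamma_pow].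
by rewrite -gpowMn ?R ?gpow1n // cen.
Qed.

Lemma gcomm_mul_pow x y j : [~ x, y * x ^+ j] = [~ x, y].
Proof.
have C := gcommuteV (esym (gcommute_pow j (erefl (x * x)))).
move: (x ^+ j) C => h C.
have -> : [~ x, y * h] = x * y * (h * x^-1) * h^-1 * y^-1 by grp.
rewrite C; grp.
Qed.

Let comm2 x y : gam 2 [~ x, y]. Proof. exact: (@gamma_commS _ 1). Qed.

(** The factor 5 removes the weight six term of [gamma5_rel]. Replacing y by y x^j does not change
    [x, y], so comparing the relations [R] shows that the quadratic form [f] takes equal values at
    both. It is killed by 3, hence vanishes at x, and [R x y] loses its first factor. *)
Lemma commutator_pow5 x y : [~ y, x] ^+ (e * 5) = 1.
Proof.
have [_ _ e3 e5] := dvdn_bin_odd oe.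
have hN v : gam 5 v -> v ^+ (k * 5) = 1 by move=> gv; rewrite gpowM (gamma5_pow gv) gpow1n.
have g4 p q x' y' : gam 4 (chain [:: p; q] [~ x', y']) by do 2!apply: gamma_commS.
have R x' y' : chain [:: x'; x'] [~ y', x'] ^+ (k * 5) * [~ y', x'] ^+ (e * 5) = 1.
  have := gamma5_rel x' y' 5; rewrite (gamma4_pow gam7 cen (v := chain [:: x'; x'; x'; x'] _)).
  - by rewrite gmul1.
  - by rewrite mulnC.
  - by do 2!apply: gammaS; do 4!apply: gamma_commS.
pose f p q := to_ab gamma4_comm (chain [:: p; q] [~ x, y] ^+ (k * 5)).
have f0 : f x x = 0%R.
  apply: (@quadratic_invariant _ _ f x y).
  - by move=> p p' q; apply: (@top_slot 2 _ isT hN [::] p p' [:: q]).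
  - by move=> p q q'; apply: (@top_slot 2 _ isT hN [:: p] q q' [::]).
  - move=> p q; rewrite -to_abX; last exact/gamma_pow/g4.
    rewrite -gpowM (gamma4_pow gam7 cen _ (g4 p q x y)) ?to_ab1 //.
    by rewrite mulnAC dvdn_mulr // mulnC.
  - move=> j h ->; set z := gmul y _; have Ez : [~ x, z] = [~ x, y] by exact: gcomm_mul_pow.
    by have := R y x; have := R z x; rewrite Ez /f => <- /gmulIr ->.
have {f0} := to_ab_eq0 (gamma_pow _ (g4 _ _ _ _)) f0.
move/(@top_inv 2 _ isT hN [:: x; x] _ erefl (comm2 x y)).
by rewrite gcommV => E; rewrite -[LHS]gmul1 -E R.
Qed.

(** As for exponent e * 5, with the primes exchanged: the factor 3 removes the 'C(e, 3) term and the
    quartic form in weight six is killed by 5. *)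
Lemma commutator_pow3 x y : [~ y, x] ^+ (e * 3) = 1.
Proof.
have [_ _ e3 e5] := dvdn_bin_odd oe.
have hN v : gam 7 v -> v ^+ ('C(e, 5) * 3) = 1 by move/gam7->; rewrite gpow1n.
have g6 p q r s x' y' : gam 4 (chain [:: p; q; r; s] [~ x', y']).
  by do 2!apply: gammaS; do 4!apply: gamma_commS.
have R x' y' : chain [:: x'; x'; x'; x'] [~ y', x'] ^+ ('C(e, 5) * 3) * [~ y', x'] ^+ (e * 3) = 1.
  have := gamma5_rel x' y' 3; rewrite (gamma4_pow gam7 cen (v := chain [:: x'; x'] _)).
  - by rewrite gmulr1.
  - by rewrite mulnC.
  - by do 2!apply: gamma_commS.
pose f p q r s := to_ab gamma4_comm (chain [:: p; q; r; s] [~ x, y] ^+ ('C(e, 5) * 3)).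
have f0 : f x x x x = 0%R.
  apply: (@quartic_invariant _ _ f x y).
  - by move=> p p' q r s; apply: (@top_slot 4 _ isT hN [::] p p' [:: q; r; s]).
  - by move=> p q q' r s; apply: (@top_slot 4 _ isT hN [:: p] q q' [:: r; s]).
  - by move=> p q r r' s; apply: (@top_slot 4 _ isT hN [:: p; q] r r' [:: s]).
  - by move=> p q r s s'; apply: (@top_slot 4 _ isT hN [:: p; q; r] s s' [::]).
  - move=> p q r s; rewrite -to_abX; last exact/gamma_pow/g6.
    rewrite -gpowM (gamma4_pow gam7 cen _ (g6 p q r s x y)) ?to_ab1 //.
    by rewrite mulnAC dvdn_mulr // mulnC.
  - move=> j h ->; set z := gmul y _; have Ez : [~ x, z] = [~ x, y] by exact: gcomm_mul_pow.
    by have := R y x; have := R z x; rewrite Ez /f => <- /gmulIr ->.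
have {f0} := to_ab_eq0 (gamma_pow _ (g6 _ _ _ _ _ _)) f0.
move/(@top_inv 4 _ isT hN [:: x; x; x; x] _ erefl (comm2 x y)).
by rewrite gcommV => E; rewrite -[LHS]gmul1 -E R.
Qed.

Lemma class_six_exponent v : gam 2 v -> v ^+ e = 1.
Proof.
move: v; apply: gamma_ind => [|y x _|x _ IHx|a b ga IHa gb IHb].
- exact: gpow1n.
- apply: (@gpow_coprime _ _ 3 5) => //; rewrite mulnC;
    [exact: commutator_pow3 | exact: commutator_pow5].
- by rewrite gpowV IHx ginv1.
- by rewrite (gamma2_mul_pow gam7 oe cen gamma6_pow ga gb) IHa IHb gmul1.
Qed.

End ClassSixFinal.

(** * The exterior square and central extensions *)

(** For u in [gamma m], the elements u and [y, u] have weights adding up to 2 m + 1 and commute, so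
    centrality of u ^ e gives [y, u]^e = 1. *)
Lemma upper_half_exponent (H : Grp) e m : 0 < m ->
  (forall x y : H, x ^+ e * y = y * x ^+ e) ->
  (forall x : H, gamma (m + m).+1 x -> x = 1) ->
  forall v : H, gamma m.+1 v -> v ^+ e = 1.
Proof.
case: m => // m _ cen g1; apply: gamma_ind => [|y u gu|x _ IHx|x y gx IHx gy IHy].
- exact: gpow1n.
- have ga := gamma_commS y gu.
  have C : [~ y, u] * u = u * [~ y, u].
    by apply/esym/gcomm1P/g1; have := gamma_comm gu ga; rewrite addnS.
  have := conj_pow cen u y; rewrite (gpowMn _ C).
  by rewrite -[RHS]gmul1 => /gmulIr.
- by rewrite gpowV IHx ginv1.
- rewrite gpowMn ?IHx ?IHy ?gmul1 //; apply/gcomm1P/g1.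
  by apply: gamma_leq (gamma_comm gx gy); lia.
Qed.

Lemma nilpotent_exponent n (H : Grp) e : 0 < n -> odd e ->
  (forall x y : H, x ^+ e * y = y * x ^+ e) ->
  (forall x : H, gamma (3 * 2 ^ n).+1 x -> x = 1) ->
  forall v : H, gamma 2 v -> v ^+ (e ^ n) = 1.
Proof.
case: n => // n _ oe; elim: n H => [|n IH] H cen g1 v gv.
  by rewrite expn1; exact: (class_six_exponent g1 oe cen gv).
(* The induction hypothesis in the quotient of half the class sends the power of v into the upper
   half, which costs one more factor e. *)
have [Q [f [fM surj fker]]] := gamma_quotient H (3 * 2 ^ n.+1).+1.
have : f v ^+ (e ^ n.+1) = 1.
  apply: IH; last exact: (hom_gamma fM gv).
    by move=> p q; case: (surj p) (surj q) => {}p <- [{}q <-]; rewrite -(homX fM) -!fM cen.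
  by move=> q /(hom_gamma_surj fM surj)[p /fker + <-].
rewrite -(homX fM) => /fker gve; rewrite expnSr gpowM.
apply: upper_half_exponent cen _ _ gve; first by rewrite muln_gt0 expn_gt0.
by move=> x; rewrite addnn -mul2n mulnCA -expnS; exact: g1.
Qed.

(** * The exterior square as a crossed module over G *)

Section ExteriorSquare.
Variable G : Grp.
Implicit Types (g h k x y : G) (w u v : word G).

Definition word_inv w : word G := rev [seq (l.1, ~~ l.2) | l <- w].

Lemma word_invK w : ext_eq (word_inv w ++ w) [::].
Proof.
elim: w => [|[p b] w IH]; first exact: ext_refl.
rewrite /word_inv map_cons rev_cons cat_rcons -/(word_inv w) /=.
apply: ext_trans IH; apply: ext_cat; first exact: ext_refl.
rewrite -[w in X in ext_eq _ X]/([::] ++ w) -[_ :: _]/([:: (p, ~~ b); (p, b)] ++ w).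
apply: ext_cat (ext_refl _); rewrite -{2}[b]negbK; exact: ext_cancel.
Qed.

Let ecl (w v : word G) : w = v -> ext_eq w v.
Proof. by move=> ->; exact: ext_refl. Qed.

Definition ext_grp : Grp :=
  quot_grp (m := @cat _) (u := [::]) (i := word_inv) (@ext_refl G) (@ext_sym G)
    (@ext_trans G) (@ext_cat G) (fun w u v => ecl (catA w u v)) (fun w => ecl (erefl w)) word_invK.

Definition ext_cls w : ext_grp := quot_cls (@ext_eq G) w.
Definition wedge g h : ext_grp := ext_cls [:: (g, h, false)].

Lemma ext_clsP w v : ext_cls w = ext_cls v <-> ext_eq w v.
Proof. exact: (quot_clsP (@ext_refl G) (@ext_sym G) (@ext_trans G)). Qed.

Lemma ext_cls_cat w v : ext_cls (w ++ v) = ext_cls w * ext_cls v.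
Proof. exact: quot_clsM. Qed.

Lemma ext_cls_letter g h b :
  ext_cls [:: (g, h, b)] = if b then (wedge g h)^-1 else wedge g h.
Proof.
case: b => //; apply: (@gmul_cancel _ (wedge g h)); rewrite gmulVr -ext_cls_cat.
by apply/ext_clsP; exact: (ext_cancel (g, h) false).
Qed.

Lemma ext_cls_repr (l : ext_grp) : ext_cls (quot_repr l) = l.
Proof. exact: quot_reprK. Qed.

Lemma wedge_ind (P : ext_grp -> Prop) : P 1 ->
  (forall g h l, P l -> P (wedge g h * l)) ->
  (forall g h l, P l -> P ((wedge g h)^-1 * l)) -> forall l, P l.
Proof.
move=> P1 PM PV l; rewrite -[l]ext_cls_repr.
elim: (quot_repr l) => [|[[g h] b] w IH]; first exact: P1.
rewrite -cat1s ext_cls_cat ext_cls_letter; case: b; [exact: PV | exact: PM].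
Qed.

Lemma wedge_hom_eq (K : Grp) (f f' : ext_grp -> K) : is_hom f -> is_hom f' ->
  (forall g h, f (wedge g h) = f' (wedge g h)) -> forall l, f l = f' l.
Proof.
move=> fM fM' E; apply: wedge_ind => [|g h l IH|g h l IH].
- by rewrite (hom1 fM) (hom1 fM').
- by rewrite fM fM' E IH.
- by rewrite fM fM' (homV fM) (homV fM') E IH.
Qed.

Lemma wedge_mull g g' h : wedge (g * g') h = wedge (gconj g g') (gconj g h) * wedge g h.
Proof. by rewrite -ext_cls_cat; apply/ext_clsP; exact: ext_rel1. Qed.

Lemma wedge_mulr g h h' : wedge g (h * h') = wedge g h * wedge (gconj h g) (gconj h h').
Proof. by rewrite -ext_cls_cat; apply/ext_clsP; exact: ext_rel2. Qed.

Lemma wedgexx g : wedge g g = 1.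
Proof. by apply/ext_clsP; exact: ext_rel3. Qed.

Section Universal.
Variables (K : Grp) (phi : G -> G -> K).
Hypothesis phi_mull : forall g g' h,
  phi (g * g') h = phi (gconj g g') (gconj g h) * phi g h.
Hypothesis phi_mulr : forall g h h',
  phi g (h * h') = phi g h * phi (gconj h g) (gconj h h').
Hypothesis phixx : forall g, phi g g = 1.

Definition ext_eval (w : word G) : K :=
  foldr (fun l acc => (if l.2 then (phi l.1.1 l.1.2)^-1 else phi l.1.1 l.1.2) * acc) 1 w.

Lemma ext_eval_cat (w v : word G) : ext_eval (w ++ v) = ext_eval w * ext_eval v.
Proof. by elim: w => [|l w IH] /=; rewrite ?gmul1 // IH gmulA. Qed.

Lemma ext_eval_eq (w v : word G) : ext_eq w v -> ext_eval w = ext_eval v.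
Proof.
elim=> {w v} //=.
- by move=> w v u _ -> _ ->.
- by move=> w w' v v' _ E _ E'; rewrite !ext_eval_cat E E'.
- by move=> [g h] [] /=; rewrite gmulr1 ?gmulV ?gmulVr.
- by move=> g g' h; rewrite !gmulr1.
- by move=> g h h'; rewrite !gmulr1.
- by move=> g; rewrite gmulr1.
Qed.

Definition ext_lift (l : ext_grp) : K := ext_eval (quot_repr l).

Lemma ext_lift_cls (w : word G) : ext_lift (ext_cls w) = ext_eval w.
Proof. by apply: ext_eval_eq; apply/ext_clsP; exact: ext_cls_repr. Qed.

Lemma ext_lift_wedge g h : ext_lift (wedge g h) = phi g h.
Proof. by rewrite ext_lift_cls /= gmulr1. Qed.

Lemma ext_liftM : is_hom ext_lift.
Proof.
by move=> l m; rewrite -[l]ext_cls_repr -[m]ext_cls_repr -ext_cls_cat !ext_lift_cls ext_eval_cat.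
Qed.

End Universal.

Definition ext_bd : ext_grp -> G := ext_lift (@gcomm G).

Lemma ext_bdM : is_hom ext_bd.
Proof. by apply: ext_liftM => *; grp. Qed.

Lemma ext_bd_wedge g h : ext_bd (wedge g h) = [~ g, h].
Proof. by apply: ext_lift_wedge => *; grp. Qed.

Definition ext_act x : ext_grp -> ext_grp :=
  ext_lift (fun g h => wedge (gconj x g) (gconj x h)).

Let actP x (phi := fun g h => wedge (gconj x g) (gconj x h)) :
  [/\ forall g g' h, phi (g * g') h = phi (gconj g g') (gconj g h) * phi g h,
      forall g h h', phi g (h * h') = phi g h * phi (gconj h g) (gconj h h') &
      forall g, phi g g = 1].
Proof.
have cM g h : gconj x (g * h) = gconj x g * gconj x h by grp.
have cJ g h : gconj x (gconj g h) = gconj (gconj x g) (gconj x h) by grp.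
rewrite /phi; split=> [g g' h|g h h'|g]; last exact: wedgexx.
- by rewrite cM wedge_mull !cJ.
- by rewrite cM wedge_mulr !cJ.
Qed.

Lemma ext_actM x : is_hom (ext_act x).
Proof. by case: (actP x) => *; apply: ext_liftM. Qed.

Lemma ext_act_wedge x g h : ext_act x (wedge g h) = wedge (gconj x g) (gconj x h).
Proof. by case: (actP x) => *; apply: ext_lift_wedge. Qed.

Lemma ext_act1 l : ext_act 1 l = l.
Proof.
apply: (wedge_hom_eq (f' := id)) => [||g h]; [exact: ext_actM | by [] |].
by rewrite ext_act_wedge; congr wedge; grp.
Qed.

Lemma ext_act_mul x y l : ext_act (x * y) l = ext_act x (ext_act y l).
Proof.
apply: (wedge_hom_eq (f' := fun l => ext_act x (ext_act y l))) => [||g h].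
- exact: ext_actM.
- by move=> p q; rewrite !ext_actM.
- by rewrite !ext_act_wedge; congr wedge; grp.
Qed.

Lemma wedge_act_l x g h : wedge (x * g) h = ext_act x (wedge g h) * wedge x h.
Proof. by rewrite wedge_mull ext_act_wedge. Qed.

Lemma wedge_act_r g x h : wedge g (x * h) = wedge g x * ext_act x (wedge g h).
Proof. by rewrite wedge_mulr ext_act_wedge. Qed.

Lemma wedge1x h : wedge 1 h = 1.
Proof.
have := wedge_act_l 1 1 h; rewrite gmul1 ext_act1 -{1}[wedge 1 h]gmul1.
by move/gmulIr.
Qed.

Lemma wedgex1 h : wedge h 1 = 1.
Proof.
have := wedge_act_r h 1 1; rewrite gmul1 ext_act1 -{1}[wedge h 1]gmul1.
by move/gmulIr.
Qed.

(** Expanding (h g) /\ (h g) = 1 on both sides leaves the image under h of the product. *)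
Lemma wedge_anti g h : wedge g h * wedge h g = 1.
Proof.
have := wedgexx (h * g); rewrite wedge_act_l wedge_act_r wedgexx.
rewrite (hom1 (ext_actM h)) gmulr1.
rewrite (wedge_act_r h h g) wedgexx gmul1 -(ext_actM h) => E.
by rewrite -[LHS]ext_act1 -(gmulV h) ext_act_mul E (hom1 (ext_actM _)).
Qed.

Lemma wedge_inv_l g h : ext_act g (wedge g^-1 h) = (wedge g h)^-1.
Proof. by apply: (@gmulIr _ (wedge g h)); rewrite -wedge_act_l gmulVr gmulV wedge1x. Qed.

(* Expanding [(g * g') /\ (h * h')] from the left and from the right. *)
Lemma ext_act_swap g h l : ext_act (g * h) l * wedge g h = wedge g h * ext_act (h * g) l.
Proof.
have E g' h' : ext_act (g * h) (wedge g' h') * wedge g h =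
    wedge g h * ext_act (h * g) (wedge g' h').
  have := wedge_act_l g g' (h * h'); rewrite wedge_act_r wedge_act_l.
  rewrite (wedge_act_l g) (wedge_act_r g' h h') (wedge_act_r g h h') !ext_actM -!ext_act_mul.
  rewrite !gmulAr => /gmul_cancel E; apply: (@gmulIr _ (ext_act h (wedge g h'))).
  by rewrite !gmulAr E.
apply: (@gmulIr _ (wedge g h)^-1); rewrite gmulAr gmulVr gmulr1.
apply: (wedge_hom_eq (f' := fun l => wedge g h * ext_act (h * g) l * (wedge g h)^-1)).
- exact: ext_actM.
- by move=> p q; rewrite ext_actM; grp.
- by move=> g' h'; rewrite -E gmulAr gmulVr gmulr1.
Qed.

Lemma ext_act_comm g h l : ext_act [~ g, h] l = wedge g h * l * (wedge g h)^-1.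
Proof.
have := ext_act_swap g h (ext_act (h * g)^-1 l); rewrite -!ext_act_mul gmulVr ext_act1 => <-.
by rewrite gmulAr gmulVr gmulr1; congr ext_act; grp.
Qed.

(** The Peiffer identity of the crossed module [ext_bd]. *)
Lemma ext_peiffer m l : ext_act (ext_bd m) l = m * l * m^-1.
Proof.
elim/wedge_ind: m l => [|g h m IH|g h m IH] l.
- by rewrite (hom1 ext_bdM) ext_act1; grp.
- by rewrite ext_bdM ext_bd_wedge ext_act_mul IH ext_act_comm; grp.
- rewrite ext_bdM (homV ext_bdM) ext_bd_wedge gcommV ext_act_mul IH ext_act_comm.
  have -> : wedge h g = (wedge g h)^-1.
    by apply: (@gmul_cancel _ (wedge g h)); rewrite wedge_anti gmulVr.
  grp.
Qed.

Lemma wedge_comm_l g h k : wedge [~ g, h] k = wedge g h * (ext_act k (wedge g h))^-1.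
Proof.
(* Chosen so that h k' = k h: expanding g /\ (h k') and g /\ (k h) yields [B]. *)
set k' := h^-1 * k * h.
have A : wedge [~ g, h] k = wedge g h * (ext_act h (wedge g k'))^-1 *
    (wedge g h)^-1 * wedge g k.
  have -> : [~ g, h] = g * (h * g^-1 * h^-1) by grp.
  rewrite wedge_act_l; congr (_ * _).
  have -> : wedge (h * g^-1 * h^-1) k = ext_act h (wedge g^-1 k').
    by rewrite ext_act_wedge /k'; congr wedge; grp.
  rewrite -(homV (ext_actM h)) -wedge_inv_l -ext_act_comm -!ext_act_mul.
  by congr ext_act; grp.
have B : ext_act h (wedge g k') = (wedge g h)^-1 * (wedge g k * ext_act k (wedge g h)).
  have := wedge_act_r g h k'; have -> : h * k' = k * h by rewrite /k'; grp.
  by rewrite wedge_act_r => ->; rewrite gmulVK.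
rewrite A B; move: (wedge _ _) (wedge _ _) (ext_act _ _) => p q r; grp.
Qed.

Lemma wedge_bd_l l k : wedge (ext_bd l) k = l * (ext_act k l)^-1.
Proof.
have M p q : wedge (ext_bd p) k = p * (ext_act k p)^-1 ->
    wedge (ext_bd q) k = q * (ext_act k q)^-1 ->
    wedge (ext_bd (p * q)) k = p * q * (ext_act k (p * q))^-1.
  by move=> Ep Eq; rewrite ext_bdM wedge_act_l Ep Eq ext_peiffer ext_actM; grp.
have Vp p : wedge (ext_bd p) k = p * (ext_act k p)^-1 ->
    wedge (ext_bd p^-1) k = p^-1 * (ext_act k p^-1)^-1.
  move=> E; have := wedge_act_l (ext_bd p^-1) (ext_bd p) k.
  rewrite -ext_bdM gmulV (hom1 ext_bdM) wedge1x E ext_peiffer (homV (ext_actM k)) => Z.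
  apply: (@gmul_cancel _ ((ext_act k p)^-1 * p)).
  by move: Z; move: (wedge _ _) (ext_act k p) => X q; grp_norm => <-.
elim/wedge_ind: l => [|g h l IH|g h l IH].
- by rewrite (hom1 ext_bdM) wedge1x (hom1 (ext_actM k)); grp.
- by apply: M IH; rewrite ext_bd_wedge wedge_comm_l.
- by apply: M IH; apply: Vp; rewrite ext_bd_wedge wedge_comm_l.
Qed.

Lemma wedge_bd_r l k : wedge k (ext_bd l) = ext_act k l * l^-1.
Proof.
by apply: (@gmulIr _ (wedge (ext_bd l) k)); rewrite wedge_anti wedge_bd_l; grp.
Qed.

(* By [cov_comm], the kernel of [cov_pi] is central. *)
Record cover := Cover {
  cov_grp :> Grp;
  cov_pi : cov_grp -> G;
  cov_lam : ext_grp -> cov_grp;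
  cov_piM : is_hom cov_pi;
  cov_lamM : is_hom cov_lam;
  cov_lam_inj : forall l, cov_lam l = 1 -> l = 1;
  cov_pi_lam : forall l, cov_pi (cov_lam l) = ext_bd l;
  cov_comm : forall a b, [~ a, b] = cov_lam (wedge (cov_pi a) (cov_pi b))
}.

Lemma trivial_cover_comm (l m : ext_grp) : [~ l, m] = wedge (ext_bd l) (ext_bd m).
Proof. by rewrite wedge_bd_r ext_peiffer. Qed.

Definition trivial_cover : cover :=
  @Cover ext_grp ext_bd id ext_bdM (fun _ _ => erefl) (fun _ => id) (fun _ => erefl)
    trivial_cover_comm.

(** * Adjoining one element of G to a cover *)

Section CoverStep.
Variables (C : cover) (t : G).
Implicit Types (a b c : {a : G | gen (fun x => x = t) a}) (p q r : C).
Local Notation A := {a : G | gen (fun x => x = t) a}.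
Local Notation pi := (@cov_pi C).
Local Notation lam := (@cov_lam C).

Let lamC p l : lam (ext_act (pi p) l) = p * lam l * p^-1.
Proof.
rewrite gconjE cov_comm cov_pi_lam wedge_bd_r -(@cov_lamM C) gmulAr gmulV gmulr1 //.
Qed.

(** This is why the adjoined group is cyclic: two of its elements commute in the semidirect product,
    so [cov_comm] demands that their wedge vanish. *)
Lemma wedge_gen_cyclic a b : wedge (sval a) (sval b) = 1.
Proof.
have sub (S : G -> Prop) y : (forall x, S x -> wedge x y = 1) ->
    forall x, gen S x -> wedge x y = 1.
  move=> Sy x; elim=> {x} [|x /Sy //|x _ E|x z _ Ex _ Ez]; first exact: wedge1x.
  - have := wedge_act_l x^-1 x y; rewrite gmulV wedge1x E (hom1 (ext_actM _)) gmul1.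
    by move=> <-.
  - by rewrite wedge_act_l Ex Ez (hom1 (ext_actM _)) gmul1.
have anti x y : wedge x y = 1 -> wedge y x = 1.
  by move=> E; rewrite -[LHS]gmul1 -E wedge_anti.
apply: (sub _ _ _ _ (svalP a)) => x ->; apply: anti.
by apply: (sub _ _ _ _ (svalP b)) => y ->; exact: wedgexx.
Qed.

(* Conjugation by a lift of x sends p to [x, p] p, and [x, p] has to be the image of a wedge. *)
Definition step_phi (x : G) p : C := lam (wedge x (pi p)) * p.

Lemma step_phiM x : is_hom (step_phi x).
Proof.
move=> p q; rewrite /step_phi (@cov_piM C) wedge_act_r (@cov_lamM C) lamC; grp.
Qed.

Lemma step_phi_mul x y p : step_phi (x * y) p = step_phi x (step_phi y p).
Proof.
rewrite {3}/step_phi step_phiM /step_phi cov_pi_lam wedge_bd_r wedge_act_l !(@cov_lamM C).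
rewrite (homV (@cov_lamM C)); grp.
Qed.

Lemma step_phi1 p : step_phi 1 p = p.
Proof. by rewrite /step_phi wedge1x (hom1 (@cov_lamM C)) gmul1. Qed.

Definition step_type : Type := C * A.
Definition step_mul (u v : step_type) : step_type :=
  (u.1 * step_phi (sval u.2) v.1, exist _ (sval u.2 * sval v.2) (gen_mul (svalP u.2) (svalP v.2))).
Definition step_one : step_type := (1, exist _ 1 (gen_one _)).
Definition step_inv (u : step_type) : step_type :=
  (step_phi (sval u.2)^-1 u.1^-1, exist _ (sval u.2)^-1 (gen_inv (svalP u.2))).

Lemma step_eq (u v : step_type) : u.1 = v.1 -> sval u.2 = sval v.2 -> u = v.
Proof. by case: u v => [p a] [q b] /= -> /sval_inj ->. Qed.

Lemma step_mulA (u v w : step_type) : step_mul u (step_mul v w) = step_mul (step_mul u v) w.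
Proof.
apply: step_eq; last exact: gmulA.
by rewrite /= step_phiM step_phi_mul gmulA.
Qed.

Lemma step_mul1 (u : step_type) : step_mul step_one u = u.
Proof. by apply: step_eq => /=; rewrite ?step_phi1 gmul1. Qed.

Lemma step_mulV (u : step_type) : step_mul (step_inv u) u = step_one.
Proof. by apply: step_eq => /=; rewrite -?step_phiM gmulV // (hom1 (step_phiM _)). Qed.

Definition step_grp : Grp := Build_Grp step_mulA step_mul1 step_mulV.
Definition step_pi (u : step_grp) : G := pi u.1 * sval u.2.
Definition step_emb p : step_grp := (p, exist _ 1 (gen_one _)).

Lemma step_piM : is_hom step_pi.
Proof.
move=> [p a] [q b]; rewrite /step_pi /= /step_phi !(@cov_piM C) cov_pi_lam ext_bd_wedge; grp.
Qed.

Lemma step_embM : is_hom step_emb.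
Proof. by move=> p q; apply: step_eq; rewrite /= ?step_phi1 ?gmul1. Qed.

Lemma step_comm (u v : step_grp) :
  [~ u, v] = step_emb (lam (wedge (step_pi u) (step_pi v))).
Proof.
apply: (@gmulIr _ (v * u)); have -> : [~ u, v] * (v * u) = u * v by grp.
case: u v => [p a] [q b]; have ab := wedge_gen_cyclic a b.
have abC : sval a * sval b = sval b * sval a.
  by apply/gcomm1P; rewrite -ext_bd_wedge ab (hom1 ext_bdM).
apply: step_eq; rewrite /step_pi /= ?step_phi1 ?gmul1 //.
move: (sval a) (sval b) ab => x y xy.
rewrite wedge_act_l !wedge_act_r xy (hom1 (ext_actM _)) gmulr1 !(@cov_lamM C) !lamC /step_phi.
have K : lam (wedge (pi p) y) * lam (wedge y (pi p)) = 1.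
  by rewrite -(@cov_lamM C) wedge_anti (hom1 (@cov_lamM C)).
rewrite -cov_comm.
have -> : lam (wedge (pi p) y) = (lam (wedge y (pi p)))^-1.
  by apply: (@gmulIr _ (lam (wedge y (pi p)))); rewrite K gmulV.
grp.
Qed.

(** Closed by [Defined] so that the projections of the new cover compute in [cover_step]. *)
Definition step_cover : cover.
Proof.
refine (@Cover step_grp step_pi (fun l => step_emb (lam l)) step_piM _ _ _ step_comm).
- by move=> l m; rewrite (@cov_lamM C) step_embM.
- by move=> l [/cov_lam_inj].
- by move=> l; rewrite /step_pi /= gmulr1 cov_pi_lam.
Defined.

End CoverStep.

Lemma cover_step (C : cover) t : exists (C' : cover) (f : C -> C') (y : C'),
  [/\ is_hom f, forall l, @cov_lam C' l = f (@cov_lam C l),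
      forall p, cov_pi (f p) = cov_pi p & cov_pi y = t].
Proof.
exists (step_cover C t), (@step_emb C t).
have gt : gen (fun x => x = t) t by exact: gen_in.
exists (1, exist _ t gt); split; [exact: step_embM | by [] | |].
  by move=> p; rewrite /= /step_pi /= gmulr1.
by rewrite /= /step_pi /= (hom1 (@cov_piM C)) gmul1.
Qed.

(** Once g and h have lifts, [cov_comm] turns g /\ h into their commutator. The cover depends on the
    element [l], through the letters of a word for it. *)
Lemma cover_wedges (l : ext_grp) : exists C : cover, gamma 2 (@cov_lam C l).
Proof.
have step g h (m : ext_grp) : (exists C : cover, gamma 2 (@cov_lam C m)) ->
    exists C : cover, gamma 2 (@cov_lam C m) /\ gamma 2 (@cov_lam C (wedge g h)).
  case=> C gm; have [C1 [f1 [x [f1M E1 _ Ex]]]] := cover_step C g.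
  have [C2 [f2 [y [f2M E2 P2 Ey]]]] := cover_step C1 h.
  exists C2; split; first by rewrite E2 E1; apply/(hom_gamma f2M)/(hom_gamma f1M).
  by rewrite -Ex -P2 -Ey -cov_comm; exact: (@gamma_commS _ 1%N).
elim/wedge_ind: l => [|g h l /(step g h)[C [gl gw]]|g h l /(step g h)[C [gl gw]]].
- by exists trivial_cover; exact: gamma_one.
- by exists C; rewrite (@cov_lamM C); exact: gamma_mul.
- by exists C; rewrite (@cov_lamM C) (homV (@cov_lamM C)); apply: gamma_mul => //; exact: gamma_inv.
Qed.

End ExteriorSquare.

Lemma ext_exponent (G : Grp) c e n : 0 < n -> c.+1 <= 3 * 2 ^ n -> odd e ->
  (forall x : G, x ^+ e = 1) -> (forall x : G, gamma c.+1 x -> x = 1) ->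
  ext_exp_dvd G (e ^ n).
Proof.
move=> n0 cn oe Ge Gc w; apply/ext_clsP.
have [C gw] := cover_wedges (ext_cls w).
have piM := @cov_piM _ C; have lamM := @cov_lamM _ C.
have cen (x y : C) : x ^+ e * y = y * x ^+ e.
  by apply/gcomm1P; rewrite cov_comm (homX piM) Ge wedge1x (hom1 lamM).
(* A commutator [x, y] with y in [gamma c.+1] is the image of a wedge whose second entry lies in the
   trivial [gamma c.+1] of G; so the cover has class at most c + 1. *)
have nil (v : C) : gamma (3 * 2 ^ n).+1 v -> v = 1.
  move=> gv; have {gv} : gamma c.+2 v by apply: gamma_leq gv; rewrite ltnS.
  move: v; apply: gamma_ind => [//|x y gy|x _ ->|x y _ -> _ ->]; rewrite ?ginv1 ?gmul1 //.
  by rewrite cov_comm (Gc (cov_pi y)) ?wedgex1 ?(hom1 lamM) //; exact: hom_gamma.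
have E := nilpotent_exponent n0 oe cen nil gw.
have -> : ext_cls (wpow w (e ^ n)) = ext_cls w ^+ (e ^ n).
  elim: (e ^ n) => // m IH.
  by rewrite /wpow /= ext_cls_cat -/(wpow w m) IH.
by apply: (@cov_lam_inj _ C); rewrite (homX lamM).
Qed.

Local Close Scope grp_scope.

Theorem theorem5p3 (G : Grp) (c e n : nat) :
  2 < c ->
  nilpotent_class G c ->
  (* n = ceil (log_2 ((c+1)/3)) : the least n with (c+1)/3 <= 2^n *)
  c.+1 <= 3 * 2 ^ n -> (forall m, c.+1 <= 3 * 2 ^ m -> n <= m) ->
  has_exponent G e -> odd e ->
  ext_exp_dvd G (e ^ n) /\ schur_exp_dvd G (e ^ n).
Proof.
move=> c2 [Gc _] cn _ [_ [Ge _]] oe.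
(* n = 0 would mean c + 1 <= 3, against c > 2. *)
have n0 : 0 < n by case: n cn => // cn; lia.
have E := ext_exponent n0 cn oe Ge Gc.
by split=> // w _; exact: E.
Qed.
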